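(* Let $U\subseteq\mathbb{R}^n$ be open and convex. For every convex function $f:U\to\mathbb{R}$ and every real number $\varepsilon>0$ there exists a real-analytic convex function $g:U\to\mathbb{R}$ such that $f(x)-\varepsilon\leq g(x)\leq f(x)$ for all $x\in U$.
   Context: No Lipschitz, strict or strong convexity assumption is made on $f$, and $U$ need not be bounded. *)

(* Defs.v *)
From mathcomp Require Import all_boot all_order all_algebra.
From mathcomp Require Import all_classical all_reals all_analysis.

Set Implicit Arguments.
Unset Strict Implicit.
Unset Printing Implicit Defensive.

Import Order.TTheory GRing.Theory Num.Theory numFieldNormedType.Exports.

Local Open Scope classical_set_scope.
Local Open Scope ring_scope.

(* The family u is absolutely summable with sum s: \esum is only meaningful
   for nonnegative terms, so the signed sum is the difference of the sums of
   the positive and negative parts. *)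
Definition has_abs_sum (R : realType) (I : choiceType) (u : I -> R) (s : R) :
    Prop :=
  let ue := fun i => (u i)%:E in
  summable [set: I] ue /\
  ((\esum_(i in [set: I]) ue^\+ i) - (\esum_(i in [set: I]) ue^\- i) = s%:E)%E.

Definition monomial (R : realType) (n : nat) (alpha : {ffun 'I_n -> nat})
    (x : 'rV[R]_n) : R :=
  \prod_(i < n) x ord0 i ^+ alpha i.

(* Near every point a of D, g is the sum of an absolutely convergent power
   series in the n variables x - a. Only the germs of g at points of D matter;
   for open D this depends only on the restriction of g to D. *)
Definition real_analytic_on (R : realType) (n : nat) (D : set 'rV[R]_n)
    (g : 'rV[R]_n -> R) : Prop :=
  forall a, D a -> exists c : {ffun 'I_n -> nat} -> R,
    \forall x \near a,
      has_abs_sum (fun alpha => c alpha * monomial alpha (x - a)) (g x).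

(* Main.v *)
Require Import Defs.
From mathcomp Require Import all_boot all_order all_algebra.
From mathcomp Require Import all_classical all_reals all_analysis.
From mathcomp Require Import ring lra.
Import Order.TTheory GRing.Theory Num.Theory numFieldNormedType.Exports.
Local Open Scope classical_set_scope.
Local Open Scope ring_scope.

(** Choose affine minorants l_k of f, within eps of it at every point, such that
    near each point all but finitely many of them stay strictly below their
    supremum.  With rates m_k growing linearly in k, the equation

      sum_k exp (m_k (l_k x - t)) = 1

    then defines t = g x.  The exponentials are convex in (x, t), hence so is g;
    each term being at most 1 gives l_k <= g, and the sum at t = f x being at
    most 1 gives g <= f.  Locally the series converges in a weighted l^1 algebra
    of power series, where Newton's map for the equation is a contraction, so g
    is real analytic.

    The l_k are tangents of a strictly convex approximation of f, taken at finitely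
    many points of each layer of a compact exhaustion of U.  Such an approximation
    exists once f is bounded below by constants and by translates of all coordinate
    functions; up to an affine function and a linear change of variables this holds
    after factoring out the directions along which f is affine and U is invariant. *)

Set Implicit Arguments.
Unset Strict Implicit.
Unset Printing Implicit Defensive.

(** Hence the construction from affine functions only. The distance by which the far minorants stay
    below the supremum has no positive lower bound valid on all of [U]; linear rates cope with this,
    since the series of exp (- m_k eta) converges geometrically for every eta > 0.

    Complexification is avoided as well. The weighted l^1 norm of an affine function on a ball is
    its supremum there, so real bounds on a slightly larger ball control each exponential as an
    element of the algebra.

    Factoring out directions is forced: a convex function on a line at bounded distance from an
    affine one is itself affine, so an [f] that is affine along a line contained in [U] has no
    strictly convex approximation at bounded distance. *)

(** * Unordered sums of nonnegative extended reals *)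

Section nonnegative_families.
Context {R : realType}.
Local Open Scope ereal_scope.

Lemma ge0_esumZl (I : choiceType) (a : I -> \bar R) (c : R) :
  (0 <= c)%R -> (forall i, 0 <= a i) ->
  \esum_(i in [set: I]) (c%:E * a i) = c%:E * \esum_(i in [set: I]) a i.
Proof.
have le (d : R) (b : I -> \bar R) : (0 <= d)%R -> (forall i, 0 <= b i) ->
    \esum_(i in [set: I]) (d%:E * b i) <= d%:E * \esum_(i in [set: I]) b i.
  move=> d0 b0; apply: ge_ereal_sup => /= _ [X [finX _]] <-.
  rewrite -ge0_mule_fsumr//; apply: lee_wpmul2l; first by rewrite lee_fin.
  by apply: ereal_sup_ubound; exists X.
move=> c0 a0; have [->|cn0] := eqVneq c 0%R.
  by rewrite mul0e esum1// => i _; rewrite mul0e.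
have cp : (0 < c)%R by rewrite lt_neqAle eq_sym cn0.
apply/eqP; rewrite eq_le le//=.
rewrite -[leRHS]mul1e -(@divff _ c)// EFinM -muleA.
apply: lee_wpmul2l; first by rewrite lee_fin.
apply: (le_trans _ (le _ (fun i => c%:E * a i) _ _)).
- under [leRHS]eq_esum do rewrite muleA -EFinM mulVf// mul1e.
  exact: lexx.
- by rewrite invr_ge0.
- by move=> i; rewrite mule_ge0// lee_fin.
Qed.

Lemma esum_fibers (I J : choiceType) (h : J -> I) (a : J -> \bar R) :
  (forall j, 0 <= a j) ->
  \esum_(i in [set: I]) \esum_(j in [set: J]) (if h j == i then a j else 0) =
  \esum_(j in [set: J]) a j.
Proof.
move=> a0; rewrite esum_esum; last by move=> i j _ _; case: ifP.
transitivity (\esum_(k in [set x : I * J | h x.2 = x.1]) a k.2).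
  rewrite esum_mkcond [RHS]esum_mkcond; apply: eq_esum => -[i j] _ /=.
  rewrite [X in if X then _ else _]mem_set//.
  by case: eqP => hj; [rewrite mem_set|rewrite memNset].
rewrite (reindex_esum [set: J] _ (fun j => (h j, j)))//.
split=> [j|j k _ _ []|[i j] /= <-]//.
by exists j.
Qed.

Lemma esum_prod (I J : choiceType) (a : I -> J -> \bar R) :
  (forall i j, 0 <= a i j) ->
  \esum_(i in [set: I]) \esum_(j in [set: J]) a i j =
  \esum_(k in [set: I * J]) a k.1 k.2.
Proof.
move=> a0; rewrite esum_esum//; congr esum.
by apply/seteqP; split.
Qed.

Lemma esum_single (I : choiceType) (a : I -> \bar R) i :
  (forall j, 0 <= a j) -> (forall j, j != i -> a j = 0) ->
  \esum_(i in [set: I]) a i = a i.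
Proof.
move=> a0 ai; rewrite (esumID [set i])// setTI esum_set1//.
rewrite [X in _ + X]esum1 ?adde0// => j [_ /= ji].
by apply: ai; apply/eqP.
Qed.

End nonnegative_families.

(** * Signed sums as differences of finite nonnegative sums *)

Section absolute_sums.
Context {R : realType}.
Implicit Types (I J : choiceType).

(** The sum is a real number, so finiteness is built in and differences of such sums need no
    extended-real subtraction. *)
Definition nnsum I (p : I -> R) (s : R) :=
  (forall i, 0 <= p i) /\ (\esum_(i in [set: I]) (p i)%:E = s%:E)%E.

Lemma nnsum_ge0 I (p : I -> R) s : nnsum p s -> 0 <= s.
Proof. by move=> [p0 ps]; rewrite -lee_fin -ps esum_ge0// => i _; rewrite lee_fin. Qed.

Lemma nnsum_bounded I (p : I -> R) (N : R) : (forall i, 0 <= p i) ->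
  (\esum_(i in [set: I]) (p i)%:E <= N%:E)%E -> exists2 s, nnsum p s & s <= N.
Proof.
move=> p0 pN; exists (fine (\esum_(i in [set: I]) (p i)%:E)).
  split=> //; rewrite fineK// fin_numElt (lt_le_trans (ltNyr 0))//=.
    by rewrite (le_lt_trans pN)// ltry.
  by apply: esum_ge0 => i _; rewrite lee_fin.
rewrite -lee_fin fineK// fin_numElt (lt_le_trans (ltNyr 0))//=.
  by rewrite (le_lt_trans pN)// ltry.
by apply: esum_ge0 => i _; rewrite lee_fin.
Qed.

Lemma nnsum_le I (p q : I -> R) s : (forall i, 0 <= p i <= q i) ->
  nnsum q s -> exists2 t, nnsum p t & t <= s.
Proof.
move=> pq [q0 qs]; apply: nnsum_bounded; first by move=> i; have /andP[] := pq i.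
by rewrite -qs; apply: le_esum => i _; rewrite lee_fin; have /andP[] := pq i.
Qed.

Lemma nnsumD I (p q : I -> R) s t : nnsum p s -> nnsum q t ->
  nnsum (fun i => p i + q i) (s + t).
Proof.
move=> [p0 ps] [q0 qt]; split=> [i|]; first by rewrite addr_ge0.
under eq_esum do rewrite EFinD.
by rewrite esumD ?ps ?qt//; move=> i _; rewrite lee_fin.
Qed.

Lemma nnsumZ I (p : I -> R) s c : 0 <= c -> nnsum p s ->
  nnsum (fun i => c * p i) (c * s).
Proof.
move=> c0 [p0 ps]; split=> [i|]; first by rewrite mulr_ge0.
under eq_esum do rewrite EFinM.
by rewrite ge0_esumZl ?ps// => i; rewrite lee_fin.
Qed.

Lemma nnsum_uniq I (p : I -> R) s t : nnsum p s -> nnsum p t -> s = t.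
Proof. by move=> [_ ps] [_]; rewrite ps => -[]. Qed.

Lemma nnsum_ext I (p q : I -> R) s : p =1 q -> nnsum p s -> nnsum q s.
Proof. by move=> /funext ->. Qed.

Lemma nnsum_prod I J (p : I -> R) (q : J -> R) s t : nnsum p s -> nnsum q t ->
  nnsum (fun k : I * J => p k.1 * q k.2) (s * t).
Proof.
move=> ps qt; split=> [k|]; first by rewrite mulr_ge0 ?ps.1 ?qt.1.
rewrite -(@esum_prod _ _ _ (fun i j => (p i * q j)%:E)); last first.
  by move=> i j; rewrite lee_fin mulr_ge0 ?ps.1 ?qt.1.
under eq_esum => i _ do rewrite (nnsumZ (ps.1 i) qt).2 mulrC.
by have [_ ->] := nnsumZ (nnsum_ge0 qt) ps; rewrite mulrC.
Qed.

Lemma nnsum_fibers I J (h : J -> I) (p : J -> R) s : nnsum p s ->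
  exists2 w, nnsum w s &
    forall i, nnsum (fun j => if h j == i then p j else 0) (w i).
Proof.
move=> ps.
have /choice[w wP] : forall i, exists w,
    nnsum (fun j => if h j == i then p j else 0) w.
  move=> i; have [|w ? _] := @nnsum_le _ (fun j => if h j == i then p j else 0) p s _ ps.
    by move=> j; case: ifP; rewrite ?lexx ps.1.
  by exists w.
exists w => //; split=> [i|]; first exact: nnsum_ge0 (wP i).
under eq_esum => i _.
  rewrite -(wP i).2; under eq_esum do rewrite (fun_if EFin).
  over.
by rewrite esum_fibers ?ps.2// => j; rewrite lee_fin ps.1.
Qed.

Lemma has_abs_sumE I (u : I -> R) s : has_abs_sum u s <->
  exists P Q, [/\ nnsum (fun i => Num.max (u i) 0) P,
    nnsum (fun i => Num.max (- u i) 0) Q & s = P - Q].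
Proof.
have m0 (x : R) : 0 <= Num.max x 0 by rewrite le_max lexx orbT.
have Ep : (fun i => (Num.max (u i) 0)%:E) = (fun i => (u i)%:E)^\+%E.
  by apply/funext => i; rewrite funeposE EFin_max.
have En : (fun i => (Num.max (- u i) 0)%:E) = (fun i => (u i)%:E)^\-%E.
  by apply/funext => i; rewrite funenegE EFin_max EFinN.
split=> [[su us]|[P [Q [[_ uP] [_ uQ] ->]]]].
- have fin (a : I -> R) : (forall i, 0 <= a i <= `|u i|) -> exists t, nnsum a t.
    move=> au; have a0 i : 0 <= a i by have /andP[] := au i.
    exists (fine (\esum_(i in [set: I]) (a i)%:E)); split=> //.
    rewrite fineK// fin_numElt (lt_le_trans (ltNyr 0)) ?esum_ge0//=.
      by apply: le_lt_trans su; apply: le_esum => i _; rewrite lee_fin; have /andP[] := au i.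
    by move=> i _; rewrite lee_fin.
  have [P uP] : exists P, nnsum (fun i => Num.max (u i) 0) P.
    by apply: fin => i; rewrite m0 ge_max ler_norm normr_ge0.
  have [Q uQ] : exists Q, nnsum (fun i => Num.max (- u i) 0) Q.
    by apply: fin => i; rewrite m0 ge_max ler_normr lexx orbT normr_ge0.
  exists P, Q; split=> //.
  by move: us; rewrite -Ep -En uP.2 uQ.2 -EFinB => -[].
- split; last by rewrite -Ep -En uP uQ -EFinB.
  rewrite /summable.
  under eq_esum => i _.
    have -> : (`|(u i)%:E| = (Num.max (u i) 0)%:E + (Num.max (- u i) 0)%:E)%E.
      rewrite -EFinD /=; congr EFin; have [u0|u0] := leP 0 (u i).
        by rewrite ger0_norm// max_r ?oppr_le0// addr0.
      by rewrite ltr0_norm// max_l ?add0r// oppr_ge0 ltW.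
    over.
  by rewrite esumD ?uP ?uQ -?EFinD ?ltry// => i _; rewrite lee_fin.
Qed.

(** The splitting need not be into positive and negative parts, so every operation on signed sums
    can be carried out on whichever nonnegative families it produces. *)
Lemma has_abs_sumB I (p q : I -> R) s t : nnsum p s -> nnsum q t ->
  has_abs_sum (fun i => p i - q i) (s - t).
Proof.
move=> [p0 ps] [q0 qt].
have sp (a : I -> R) c : (forall i, 0 <= a i) ->
    (\esum_(i in [set: I]) (a i)%:E = c%:E)%E ->
    summable [set: I] (fun i => (a i)%:E).
  move=> a0 ac; rewrite /summable.
  by under eq_esum do rewrite gee0_abs ?lee_fin//; rewrite ac ltry.
have Eu : (fun i => (p i - q i)%:E) =
    ((fun i => (p i)%:E) \- (fun i => (q i)%:E))%E.
  by apply/funext => i; rewrite EFinB.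
split; first by rewrite Eu; apply: summableB; [exact: sp ps|exact: sp qt].
rewrite Eu esumB ?ps ?qt ?EFinB//.
- exact: sp ps.
- exact: sp qt.
- by move=> i _; rewrite lee_fin.
- by move=> i _; rewrite lee_fin.
Qed.

End absolute_sums.

(** * Linearity, products and regrouping of absolutely convergent sums *)

Section absolute_sum_operations.
Context {R : realType}.
Implicit Types (I J : choiceType).

Lemma has_abs_sum_ext I (u v : I -> R) s :
  u =1 v -> has_abs_sum u s -> has_abs_sum v s.
Proof. by move=> /funext ->. Qed.

Lemma has_abs_sum_decomp I (u : I -> R) s : has_abs_sum u s ->
  exists p q P Q, [/\ nnsum p P, nnsum q Q, u = (fun i => p i - q i) & s = P - Q].
Proof.
move=> /has_abs_sumE[P [Q [uP uQ ->]]].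
exists (fun i => Num.max (u i) 0), (fun i => Num.max (- u i) 0), P, Q; split=> //.
apply/funext => i; have [u0|u0] := leP 0 (u i).
  by rewrite max_r ?oppr_le0// subr0.
by rewrite max_l ?oppr_ge0 ?ltW// sub0r opprK.
Qed.

Lemma has_abs_sum_uniq I (u : I -> R) s t :
  has_abs_sum u s -> has_abs_sum u t -> s = t.
Proof. by move=> [_ us] [_]; rewrite us => -[]. Qed.

Lemma nnsum_has_abs_sum I (p : I -> R) s : nnsum p s -> has_abs_sum p s.
Proof.
move=> ps; have q0 : nnsum (fun i : I => 0 : R) 0.
  by split=> //; rewrite esum1.
have := has_abs_sumB ps q0; rewrite subr0; apply: has_abs_sum_ext => i.
by rewrite subr0.
Qed.

Lemma has_abs_sumD I (u v : I -> R) s t : has_abs_sum u s -> has_abs_sum v t ->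
  has_abs_sum (fun i => u i + v i) (s + t).
Proof.
move=> /has_abs_sum_decomp[p [q [P [Q [pP qQ -> ->]]]]].
move=> /has_abs_sum_decomp[p' [q' [P' [Q' [pP' qQ' -> ->]]]]].
have := has_abs_sumB (nnsumD pP pP') (nnsumD qQ qQ').
by rewrite opprD addrACA; apply: has_abs_sum_ext => i; rewrite opprD addrACA.
Qed.

Lemma has_abs_sumZ I (u : I -> R) s c : has_abs_sum u s ->
  has_abs_sum (fun i => c * u i) (c * s).
Proof.
move=> /has_abs_sum_decomp[p [q [P [Q [pP qQ -> ->]]]]].
have [c0|c0] := leP 0 c.
  have := has_abs_sumB (nnsumZ c0 pP) (nnsumZ c0 qQ).
  by rewrite mulrBr; apply: has_abs_sum_ext => i; rewrite mulrBr.
have c1 : 0 <= - c by rewrite oppr_ge0 ltW.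
have := has_abs_sumB (nnsumZ c1 qQ) (nnsumZ c1 pP).
by rewrite (_ : _ - _ = c * (P - Q)); [apply: has_abs_sum_ext => i|]; ring.
Qed.

Lemma has_abs_sum_prod I J (u : I -> R) (v : J -> R) s t :
  has_abs_sum u s -> has_abs_sum v t ->
  has_abs_sum (fun k : I * J => u k.1 * v k.2) (s * t).
Proof.
move=> /has_abs_sum_decomp[p [q [P [Q [pP qQ -> ->]]]]].
move=> /has_abs_sum_decomp[p' [q' [P' [Q' [pP' qQ' -> ->]]]]].
have := has_abs_sumB (nnsumD (nnsum_prod pP pP') (nnsum_prod qQ qQ'))
  (nnsumD (nnsum_prod pP qQ') (nnsum_prod qQ pP')).
rewrite (_ : _ - _ = (P - Q) * (P' - Q')); last by ring.
by apply: has_abs_sum_ext => i; ring.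
Qed.

Lemma has_abs_sum_bound I (u : I -> R) N :
  (\esum_(i in [set: I]) `|u i|%:E <= N%:E)%E ->
  exists2 s, has_abs_sum u s & `|s| <= N.
Proof.
move=> uN; have [t ut tN] := nnsum_bounded (fun i => normr_ge0 (u i)) uN.
have m0 (x : R) : 0 <= Num.max x 0 by rewrite le_max lexx orbT.
have [|P uP _] := @nnsum_le _ _ (fun i => Num.max (u i) 0) _ _ _ ut.
  by move=> i; rewrite m0 ge_max ler_norm normr_ge0.
have [|Q uQ _] := @nnsum_le _ _ (fun i => Num.max (- u i) 0) _ _ _ ut.
  by move=> i; rewrite m0 ge_max ler_normr lexx orbT normr_ge0.
exists (P - Q); first by apply/has_abs_sumE; exists P, Q.
have PQt : P + Q = t.
  apply: nnsum_uniq (nnsumD uP uQ) _; apply: nnsum_ext ut => i.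
  have [u0|u0] := leP 0 (u i).
    by rewrite ger0_norm// max_r ?oppr_le0// addr0.
  by rewrite ltr0_norm// max_l ?add0r// oppr_ge0 ltW.
have := nnsum_ge0 uP; have := nnsum_ge0 uQ.
rewrite ler_norml; lra.
Qed.

Lemma has_abs_sum_norm_le I (u : I -> R) s N : has_abs_sum u s ->
  (\esum_(i in [set: I]) `|u i|%:E <= N%:E)%E -> `|s| <= N.
Proof. by move=> us /has_abs_sum_bound[t /has_abs_sum_uniq/(_ us) ->]. Qed.

Lemma has_abs_sum_fibers I J (h : J -> I) (v : J -> R) s (w : I -> R) :
  has_abs_sum v s ->
  (forall i, has_abs_sum (fun j => if h j == i then v j else 0) (w i)) ->
  has_abs_sum w s.
Proof.
move=> /has_abs_sum_decomp[p [q [P [Q [pP qQ -> ->]]]]] vw.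
have [p' pP' p'E] := nnsum_fibers h pP; have [q' qQ' q'E] := nnsum_fibers h qQ.
apply: has_abs_sum_ext (has_abs_sumB pP' qQ') => i.
apply: has_abs_sum_uniq (vw i).
apply: has_abs_sum_ext (has_abs_sumB (p'E i) (q'E i)) => j.
by case: ifP => _ //; rewrite subr0.
Qed.

Lemma nnsum_row I J (p : J -> R) s (k : I) : nnsum p s ->
  nnsum (fun x : I * J => if x.1 == k then p x.2 else 0) s.
Proof.
move=> [p0 ps]; split=> [x|]; first by case: ifP.
rewrite -(@esum_prod _ _ _ (fun i j => (if i == k then p j else 0)%:E)).
  rewrite (@esum_single _ _ _ k) ?eqxx//.
    by move=> j; apply: esum_ge0 => i _; rewrite lee_fin; case: ifP.
  by move=> j /negbTE ->; rewrite esum1.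
by move=> i j; rewrite lee_fin; case: ifP.
Qed.

(** Fubini from rows to pairs: the bound makes the family on pairs summable, and grouping along the
    first projection identifies its total with [s]. *)
Lemma has_abs_sum_rows I J (v : I -> J -> R) (w : I -> R) s N :
  (\esum_(i in [set: I]) \esum_(j in [set: J]) `|v i j|%:E <= N%:E)%E ->
  (forall i, has_abs_sum (v i) (w i)) -> has_abs_sum w s ->
  has_abs_sum (fun k : I * J => v k.1 k.2) s.
Proof.
move=> vN vw ws; move: vN; rewrite esum_prod; last by move=> i j; rewrite lee_fin.
move=> /has_abs_sum_bound[t vt _]; have -> // : s = t.
apply: has_abs_sum_uniq ws _; apply: (has_abs_sum_fibers (h := fst) vt) => i.
have /has_abs_sum_decomp[p [q [P [Q [pP qQ vE ->]]]]] := vw i.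
apply: has_abs_sum_ext (has_abs_sumB (nnsum_row i pP) (nnsum_row i qQ)).
by move=> [a b] /=; have [->|_] := eqVneq a i; rewrite ?vE ?subr0.
Qed.

Lemma esum_nat_le (a : nat -> R) (N : R) : (forall k, 0 <= a k) ->
  (forall m, \sum_(0 <= k < m) a k <= N) ->
  (\esum_(i in [set: nat]) (a i)%:E <= N%:E)%E.
Proof.
move=> a0 aN; rewrite -nneseries_esumT; last by move=> n; rewrite lee_fin.
apply: lime_le; first by apply: is_cvg_nneseries => n _ _; rewrite lee_fin.
by apply: nearW => n; rewrite sumEFin lee_fin.
Qed.

(** The absolute bound makes the limit of the ordered partial sums agree with the unordered sum. *)
Lemma has_abs_sum_series (u : nat -> R) (N s : R) :
  (forall m, \sum_(0 <= k < m) `|u k| <= N) ->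
  (fun m => \sum_(0 <= k < m) u k) @ \oo --> s -> has_abs_sum u s.
Proof.
move=> uN us; have /has_abs_sum_bound[t ut _] := esum_nat_le (fun k => normr_ge0 (u k)) uN.
have -> // : s = t.
have [su uE] := ut.
have PT : [set: nat] = xpredT :> set nat by apply/seteqP; split.
rewrite PT in su uE; have := summable_eseries_esum su; rewrite [RHS]uE => uE'.
apply: EFin_inj; rewrite -uE'; apply/esym/cvg_lim => //.
under eq_fun do rewrite sumEFin.
by apply/fine_cvgP; split=> //; apply: nearW.
Qed.

End absolute_sum_operations.

(** * The weighted l^1 algebra of power series on a closed ball *)

Section power_series_algebra.
Context {R : realType} {n : nat}.
Implicit Types (a x : 'rV[R]_n) (h : 'rV[R]_n -> R) (r N : R).
Local Notation mindex := {ffun 'I_n -> nat}.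

Definition mdeg (al : mindex) : nat := (\sum_(i < n) al i)%N.

Lemma coord_le_norm (y : 'rV[R]_n) i : `|y ord0 i| <= `|y|.
Proof.
rewrite [leRHS]/Num.Def.normr /= mx_normrE.
exact: (le_bigmax _ (fun ij => `|y ij.1 ij.2|) (ord0, i)).
Qed.

Lemma monomial_le (al : mindex) (y : 'rV[R]_n) r : `|y| <= r ->
  `|monomial al y| <= r ^+ mdeg al.
Proof.
move=> yr; rewrite /monomial /mdeg normr_prod -prodrXr.
apply: ler_prod => i _; rewrite normr_ge0 normrX /=.
apply: lerXn2r; rewrite ?nnegrE//; first exact: le_trans (normr_ge0 y) yr.
exact: le_trans (coord_le_norm y i) yr.
Qed.

Lemma monomialD (al be : mindex) (y : 'rV[R]_n) :
  monomial [ffun i => (al i + be i)%N] y = monomial al y * monomial be y.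
Proof.
rewrite /monomial -big_split /=; apply: eq_bigr => i _.
by rewrite ffunE exprD.
Qed.

Lemma mdegD (al be : mindex) :
  mdeg [ffun i => (al i + be i)%N] = (mdeg al + mdeg be)%N.
Proof. by rewrite /mdeg -big_split /=; apply: eq_bigr => i _; rewrite ffunE. Qed.

(* The power series about a whose coefficients have weighted l^1 norm at most
   N form the ball of radius N of a Banach algebra; h belongs to it when it is
   the sum of such a series on the closed ball of radius r. *)
Definition power_series_on a r h N := exists c : mindex -> R,
  (\esum_(al in [set: mindex]) (`|c al| * r ^+ mdeg al)%:E <= N%:E)%E /\
  forall x, `|x - a| <= r ->
    has_abs_sum (fun al => c al * monomial al (x - a)) (h x).

Local Notation ps := power_series_on.

Lemma power_series_real_analytic (D : set 'rV[R]_n) g :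
  (forall a, D a -> exists2 r, 0 < r & exists N, ps a r g N) ->
  real_analytic_on D g.
Proof.
move=> Dg a /Dg[r r0 [N [c [_ cg]]]]; exists c.
apply/nbhs_ballP; exists r => //= x; rewrite -ball_normE /= => xa.
by apply: cg; rewrite distrC ltW.
Qed.

(** Exponents may repeat over an arbitrary index set: pairs for products and for series, a single
    index for monomials. Collecting equal exponents can only lower the weighted norm, by the
    triangle inequality. *)
Lemma ps_regroup (J : choiceType) a r h N (c : J -> R) (al : J -> mindex) :
  0 < r ->
  (\esum_(j in [set: J]) (`|c j| * r ^+ mdeg (al j))%:E <= N%:E)%E ->
  (forall x, `|x - a| <= r ->
    has_abs_sum (fun j => c j * monomial (al j) (x - a)) (h x)) ->
  ps a r h N.
Proof.
move=> r0 cN ch.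
have rX k : 0 < r ^+ k by rewrite exprn_gt0.
have fib i : (\esum_(j in [set: J])
    (if al j == i then `|c j| * r ^+ mdeg (al j) else 0)%:E <= N%:E)%E.
  apply: le_trans cN; apply: le_esum => j _; rewrite lee_fin.
  by case: ifP => // _; rewrite mulr_ge0// ltW.
have /choice[c' cP] : forall i, exists s,
    has_abs_sum (fun j => if al j == i then c j else 0) s /\
    (`|s * r ^+ mdeg i|%:E <= \esum_(j in [set: J])
      (if al j == i then `|c j| * r ^+ mdeg (al j) else 0)%:E)%E.
  (* The weight is kept in the terms so that the bound on the fiber applies; dividing by it
     afterwards gives the coefficient. *)
  move=> i; set b := fun j => if al j == i then c j * r ^+ mdeg i else 0.
  have bE j : `|b j| = if al j == i then `|c j| * r ^+ mdeg (al j) else 0.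
    rewrite /b; case: eqP => [->|_]; rewrite ?normr0//.
    by rewrite normrM (gtr0_norm (rX _)).
  have [||M bM _] := @nnsum_bounded _ _ (fun j => `|b j|) N.
  - by [].
  - by under eq_esum do rewrite bE; exact: fib.
  have [|s bs sM] := @has_abs_sum_bound _ _ b M; first by rewrite bM.2.
  exists (s / r ^+ mdeg i); split.
    rewrite mulrC; have := has_abs_sumZ (r ^+ mdeg i)^-1 bs.
    apply: has_abs_sum_ext => j; rewrite /b; case: ifP => _; last by rewrite mulr0.
    by rewrite mulrCA mulVf ?mulr1// gt_eqF.
  rewrite divfK ?gt_eqF//; under eq_esum do rewrite -bE.
  by rewrite bM.2 lee_fin.
exists c'; split.
  apply: le_trans cN.
  rewrite -(esum_fibers al); last by move=> j; rewrite lee_fin mulr_ge0// ltW.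
  apply: le_esum => i _.
  have [_] := cP i; rewrite normrM (gtr0_norm (rX _)) => /le_trans; apply.
  by apply: le_esum => j _; case: ifP.
move=> x xr; apply: (has_abs_sum_fibers (h := al) (ch x xr)) => i.
have [ci _] := cP i; rewrite mulrC.
apply: has_abs_sum_ext (has_abs_sumZ (monomial i (x - a)) ci) => j.
by case: eqP => [->|_]; rewrite ?mulr0// mulrC.
Qed.

Lemma ps_le a r h N M : N <= M -> ps a r h N -> ps a r h M.
Proof.
by move=> NM [c [cN ch]]; exists c; split=> //; apply: le_trans cN _; rewrite lee_fin.
Qed.

Lemma ps_ext a r h h' N : (forall x, `|x - a| <= r -> h x = h' x) ->
  ps a r h N -> ps a r h' N.
Proof.
by move=> hh' [c [cN ch]]; exists c; split=> // x xr; rewrite -hh'//; apply: ch.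
Qed.

Lemma ps_bound a r h N x : ps a r h N -> `|x - a| <= r -> `|h x| <= N.
Proof.
move=> [c [cN ch]] xr; apply: has_abs_sum_norm_le (ch x xr) _.
apply: le_trans cN; apply: le_esum => al _; rewrite lee_fin normrM.
by rewrite ler_wpM2l// monomial_le.
Qed.

Lemma ps0 a r : 0 <= r -> ps a r (fun=> 0) 0.
Proof.
move=> r0; exists (fun=> 0); split.
  by rewrite esum1// => al _; rewrite normr0 mul0r.
move=> x _; apply: nnsum_has_abs_sum; split=> [i|]; first by rewrite mul0r.
by rewrite esum1// => al _; rewrite mul0r.
Qed.

Lemma psD a r h h' N N' : 0 < r -> ps a r h N -> ps a r h' N' ->
  ps a r (fun x => h x + h' x) (N + N').
Proof.
move=> r0 [c [cN ch]] [c' [cN' ch']]; exists (fun al => c al + c' al); split.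
  have rX k : 0 <= r ^+ k by rewrite exprn_ge0// ltW.
  rewrite EFinD; apply: le_trans (leeD cN cN').
  rewrite -esumD; last 2 first.
    by move=> al _; rewrite lee_fin mulr_ge0.
    by move=> al _; rewrite lee_fin mulr_ge0.
  apply: le_esum => al _; rewrite -EFinD lee_fin -mulrDl.
  by rewrite ler_wpM2r// ler_normD.
move=> x xr; apply: has_abs_sum_ext (has_abs_sumD (ch x xr) (ch' x xr)) => al.
by rewrite mulrDl.
Qed.

Lemma psZ a r h N k : 0 < r -> ps a r h N ->
  ps a r (fun x => k * h x) (`|k| * N).
Proof.
move=> r0 [c [cN ch]]; exists (fun al => k * c al); split.
  have rX j : 0 <= r ^+ j by rewrite exprn_ge0// ltW.
  under eq_esum do rewrite normrM -mulrA EFinM.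
  rewrite ge0_esumZl//; last by move=> al; rewrite lee_fin mulr_ge0.
  by rewrite EFinM; apply: lee_wpmul2l.
move=> x xr; apply: has_abs_sum_ext (has_abs_sumZ k (ch x xr)) => al.
by rewrite mulrA.
Qed.

Lemma psB a r h h' N N' : 0 < r -> ps a r h N -> ps a r h' N' ->
  ps a r (fun x => h x - h' x) (N + N').
Proof.
move=> r0 hN h'N; have := psD r0 hN (psZ (-1) r0 h'N).
rewrite normrN1 mul1r; apply: ps_ext => x _; by rewrite mulN1r.
Qed.

Lemma psM a r h h' N N' : 0 < r -> ps a r h N -> ps a r h' N' ->
  ps a r (fun x => h x * h' x) (N * N').
Proof.
move=> r0 [c [cN ch]] [c' [cN' ch']].
have rX j : 0 <= r ^+ j by rewrite exprn_ge0// ltW.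
have c0 al : 0 <= `|c al| * r ^+ mdeg al by rewrite mulr_ge0.
have c'0 al : 0 <= `|c' al| * r ^+ mdeg al by rewrite mulr_ge0.
apply: (@ps_regroup (mindex * mindex)%type _ _ _ _ (fun k => c k.1 * c' k.2)
  (fun k => [ffun i => (k.1 i + k.2 i)%N])) => //.
  have [s cs sN] := nnsum_bounded c0 cN; have [s' cs' sN'] := nnsum_bounded c'0 cN'.
  under eq_esum => k _.
    rewrite mdegD exprD normrM mulrACA; over.
  rewrite (nnsum_prod cs cs').2 lee_fin ler_pM//.
    exact: nnsum_ge0 cs.
  exact: nnsum_ge0 cs'.
move=> x xr; apply: has_abs_sum_ext (has_abs_sum_prod (ch x xr) (ch' x xr)) => k.
by rewrite monomialD mulrACA.
Qed.

Lemma ps_monomial a r k (al : mindex) : 0 < r ->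
  ps a r (fun x => k * monomial al (x - a)) (`|k| * r ^+ mdeg al).
Proof.
move=> r0; apply: (@ps_regroup unit _ _ _ _ (fun=> k) (fun=> al)) => //.
  rewrite (@esum_single _ _ _ tt)//.
  by move=> j; rewrite lee_fin mulr_ge0// exprn_ge0// ltW.
move=> x xr; have nn (b : R) : 0 <= b -> nnsum (fun _ : unit => b) b.
  by move=> b0; split=> //; rewrite (@esum_single _ _ _ tt).
have [b0|b0] := leP 0 (k * monomial al (x - a)).
  exact: nnsum_has_abs_sum (nn _ b0).
rewrite -(opprK (k * _)) -(sub0r (- _)).
apply: has_abs_sum_ext (has_abs_sumB (nn 0 _) (nn (- (k * monomial al (x - a))) _)).
- by [].
- by [].
- by rewrite oppr_ge0 ltW.
Qed.

Lemma ps_cst a r k : 0 < r -> ps a r (fun=> k) `|k|.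
Proof.
move=> r0; have := ps_monomial a k [ffun=> 0%N] r0.
rewrite /mdeg big1 ?expr0 ?mulr1; last by move=> i _; rewrite ffunE.
apply: ps_ext => x _; rewrite /monomial big1 ?mulr1// => i _.
by rewrite ffunE expr0.
Qed.

Lemma ps_coord a r i : 0 < r -> ps a r (fun x => (x - a) ord0 i) r.
Proof.
move=> r0; have := ps_monomial a 1 [ffun j => (j == i : nat)] r0.
rewrite /mdeg (bigD1 i)//= big1 => [|j /negbTE ji]; last by rewrite ffunE ji.
rewrite ffunE eqxx addn0 expr1 normr1 mul1r; apply: ps_ext => x _.
rewrite mul1r /monomial (bigD1 i)//= big1 => [|j /negbTE ji]; last first.
  by rewrite ffunE ji expr0.
by rewrite ffunE eqxx mulr1 expr1.
Qed.

Lemma ps_sum (I : Type) (s : seq I) a r (h : I -> 'rV[R]_n -> R) (N : I -> R) :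
  0 < r -> (forall i, ps a r (h i) (N i)) ->
  ps a r (fun x => \sum_(i <- s) h i x) (\sum_(i <- s) N i).
Proof.
move=> r0 hN; elim: s => [|i s IH].
  rewrite big_nil; apply: ps_ext (ps0 a (ltW r0)) => x _; by rewrite big_nil.
rewrite big_cons; apply: ps_ext (psD r0 (hN i) IH) => x _.
by rewrite big_cons.
Qed.

Lemma psX a r h N k : 0 < r -> ps a r h N -> ps a r (fun x => h x ^+ k) (N ^+ k).
Proof.
move=> r0 hN; elim: k => [|k IH].
  by rewrite expr0 -[X in ps _ _ _ X]normr1; exact: ps_cst.
by rewrite exprS; apply: ps_ext (psM r0 hN IH) => x _; rewrite exprS.
Qed.

Lemma ps_series a r (h : nat -> 'rV[R]_n -> R) (N : nat -> R) M H :
  0 < r -> (forall k, ps a r (h k) (N k)) ->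
  (forall m, \sum_(0 <= k < m) N k <= M) ->
  (forall x, `|x - a| <= r -> (fun m => \sum_(0 <= k < m) h k x) @ \oo --> H x) ->
  ps a r H M.
Proof.
move=> r0 hN NM hH; have /choice[c cP] := hN.
have rX j : 0 <= r ^+ j by rewrite exprn_ge0// ltW.
have c0 k al : 0 <= `|c k al| * r ^+ mdeg al by rewrite mulr_ge0.
have N0 k : 0 <= N k.
  by rewrite -lee_fin; apply: le_trans (cP k).1; apply: esum_ge0 => al _; rewrite lee_fin.
have cM : (\esum_(k in [set: nat]) \esum_(al in [set: mindex])
    (`|c k al| * r ^+ mdeg al)%:E <= M%:E)%E.
  apply: le_trans (esum_nat_le N0 NM).
  by apply: le_esum => k _; exact: (cP k).1.
apply: (@ps_regroup (nat * mindex)%type _ _ _ _ (fun k => c k.1 k.2) snd) => //.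
  by rewrite -(@esum_prod _ _ _ (fun k al => (`|c k al| * r ^+ mdeg al)%:E)).
move=> x xr.
apply: (@has_abs_sum_rows _ _ _ (fun k al => c k al * monomial al (x - a))
  (fun k => h k x) _ M).
- apply: le_trans cM; apply: le_esum => k _; apply: le_esum => al _.
  by rewrite lee_fin normrM ler_wpM2l// monomial_le.
- by move=> k; apply: (cP k).2.
apply: (@has_abs_sum_series _ _ M) (hH x xr) => m.
apply: le_trans (NM m); apply: ler_sum => k _.
exact: ps_bound (hN k) xr.
Qed.

End power_series_algebra.

(** * The real exponential: partial sums and a chord bound *)

Section exponential_series.
Context {R : realType}.

Lemma cvg_seq_ext (u v : nat -> R) (l : R) :
  u =1 v -> u @ \oo --> l -> v @ \oo --> l.
Proof. by move=> /funext ->. Qed.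

Lemma cvg_exp_series (x : R) :
  (fun m => \sum_(0 <= k < m) x ^+ k / k`!%:R) @ \oo --> expR x.
Proof.
have : (series (exp_coeff x)) @ \oo --> expR x.
  by rewrite /expR; apply: is_cvg_series_exp_coeff.
by [].
Qed.

Arguments cvg_exp_series : clear implicits.

Lemma exp_series_le (x : R) m : 0 <= x ->
  \sum_(0 <= k < m) x ^+ k / k`!%:R <= expR x.
Proof.
move=> x0; have cv := cvg_exp_series x; rewrite -(cvg_lim _ cv)//.
apply: (@nondecreasing_cvgn_le _ (fun m => \sum_(0 <= k < m) x ^+ k / k`!%:R)).
  apply/nondecreasing_seqP => k; rewrite big_nat_recr//= lerDl.
  by rewrite divr_ge0 ?exprn_ge0.
by apply/cvg_ex; exists (expR x).
Qed.

(** Convexity of exp, by averaging its tangent at [t * x] evaluated at 0 and at [x]. It turns the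
    shrinking of an exponent by [t] into a factor [t]. *)
Lemma expR_sub1_le (t x : R) : 0 <= t <= 1 -> expR (t * x) - 1 <= t * (expR x - 1).
Proof.
move=> t01; have tx y : expR (t * x) * (1 + (y - t * x)) <= expR y.
  rewrite -{2}(subrK (t * x) y) expRD mulrC ler_pM2r ?expR_gt0//.
  exact: expR_ge1Dx.
have := tx x; have := tx 0; rewrite expR0.
move/andP: t01 => [t0 t1] h0 h1.
have := ler_wpM2l t0 h1; have : (1 - t) * (expR (t * x) * (1 + (0 - t * x))) <= (1 - t) * 1.
  by apply: ler_wpM2l => //; rewrite subr_ge0.
lra.
Qed.

End exponential_series.
Arguments cvg_exp_series {R} x.

(** * Exponentials and fixed points in the algebra *)

Section exponential_of_power_series.
Context {R : realType} {n : nat}.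
Implicit Types (a x : 'rV[R]_n) (A B : 'rV[R]_n -> R) (r M d : R).

Lemma ps_ge0 a r A M : 0 <= r -> power_series_on a r A M -> 0 <= M.
Proof.
move=> r0 AM; have := @ps_bound _ _ _ _ _ _ a AM.
by rewrite subrr normr0 => /(_ r0); apply: le_trans.
Qed.

(** Telescoping: A^(k+2) - B^(k+2) = A (A^(k+1) - B^(k+1)) + (A - B) B^(k+1). *)
Lemma ps_subX a r A B M d k : 0 < r ->
  power_series_on a r A M -> power_series_on a r B M ->
  power_series_on a r (fun x => A x - B x) d ->
  power_series_on a r (fun x => A x ^+ k.+1 - B x ^+ k.+1) (k.+1%:R * M ^+ k * d).
Proof.
move=> r0 AM BM ABd; elim: k => [|k IH].
  by rewrite expr0 !mul1r; apply: ps_ext ABd => x _; rewrite !expr1.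
have := psD r0 (psM r0 AM IH) (psM r0 ABd (psX k.+1 r0 BM)).
rewrite (_ : _ + _ = k.+2%:R * M ^+ k.+1 * d).
  by apply: ps_ext => x _; rewrite (exprS (A x) k.+1) (exprS (B x) k.+1); ring.
by rewrite -(natr1 k.+1) exprS; ring.
Qed.

(* The exponential minus its linear part, so that small norms give a small
   Lipschitz constant. *)
Lemma ps_exp_sub a r A B M d : 0 < r ->
  power_series_on a r A M -> power_series_on a r B M ->
  power_series_on a r (fun x => A x - B x) d ->
  power_series_on a r (fun x => expR (A x) - expR (B x) - (A x - B x))
    (d * (expR M - 1)).
Proof.
move=> r0 AM BM ABd.
have M0 : 0 <= M := ps_ge0 (ltW r0) AM; have d0 : 0 <= d := ps_ge0 (ltW r0) ABd.
apply: (@ps_series _ _ a r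
  (fun k x => (k.+2`!%:R)^-1 * (A x ^+ k.+2 - B x ^+ k.+2))
  (fun k => d * (M ^+ k.+1 / k.+1`!%:R))) => //.
(* The factor k+2 from [ps_subX] cancels against the factorial; since the series starts in degree
   two, the bounds add up to [expR M - 1], without the constant term. *)
- move=> k; have <- : `|(k.+2`!%:R)^-1| * (k.+2%:R * M ^+ k.+1 * d) =
      d * (M ^+ k.+1 / k.+1`!%:R).
    rewrite ger0_norm ?invr_ge0// (factS k.+1) natrM.
    have f0 : k.+1`!%:R != 0 :> R by rewrite pnatr_eq0 -lt0n fact_gt0.
    have k0 : k.+2%:R != 0 :> R by rewrite pnatr_eq0.
    by field; rewrite f0 -natrD pnatr_eq0.
  exact: psZ (ps_subX k.+1 r0 AM BM ABd).
- move=> m; rewrite -mulr_sumr; apply: ler_wpM2l => //.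
  have := exp_series_le m.+1 M0; rewrite big_nat_recl//= expr0 fact0 divr1; lra.
- move=> x xr; have cA := cvg_exp_series (A x); have cB := cvg_exp_series (B x).
  have cAB : (fun m => \sum_(0 <= k < m) A x ^+ k / k`!%:R -
      \sum_(0 <= k < m) B x ^+ k / k`!%:R - (A x - B x)) @ \oo -->
      expR (A x) - expR (B x) - (A x - B x).
    by apply: cvgB (cvg_cst _); exact: cvgB.
  rewrite -(cvg_shiftn 2) in cAB; apply: cvg_seq_ext cAB => m.
  rewrite /= addn2 !big_nat_recl//= !expr0 !fact0 !expr1 !divr1.

  under [RHS]eq_bigr do rewrite mulrC mulrBl.
  by rewrite sumrB; ring.
Qed.

Lemma ps_exp_sub1 a r A M : 0 < r -> power_series_on a r A M ->
  power_series_on a r (fun x => expR (A x) - 1) (M * expR M).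
Proof.
move=> r0 AM.
have Z : power_series_on a r (fun=> 0) M.
  exact: ps_le (ps_ge0 (ltW r0) AM) (ps0 a (ltW r0)).
have A0 : power_series_on a r (fun x => A x - 0) M.
  by apply: ps_ext AM => x _; rewrite subr0.
have := psD r0 AM (ps_exp_sub r0 AM Z A0).
rewrite (_ : _ + _ = M * expR M); last by ring.
by apply: ps_ext => x _; rewrite expR0; ring.
Qed.

(** Started at 0, the iterates have norm at most s (1 - 2^-k) and never leave the ball. The limit
    [L] is taken pointwise; [ps_series] on the tails then puts [L] minus each iterate into the
    algebra, so that the contraction property applies to [L] itself. *)
Lemma ps_picard a r s (T : ('rV[R]_n -> R) -> 'rV[R]_n -> R) : 0 < r ->
  power_series_on a r (T (fun=> 0)) (s / 2) ->
  (forall A B d, power_series_on a r A s -> power_series_on a r B s ->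
     power_series_on a r (fun x => A x - B x) d ->
     power_series_on a r (fun x => T A x - T B x) (d / 2)) ->
  exists2 A, power_series_on a r A s & forall x, `|x - a| <= r -> T A x = A x.
Proof.
move=> r0 T0 Tc; pose A k : 'rV[R]_n -> R := iter k T (fun=> 0).
have s0 : 0 <= s by have := ps_ge0 (ltW r0) T0; rewrite pmulr_lge0// invr_gt0.
have h0 (k : nat) : (0 : R) <= 2^-1 ^+ k by rewrite exprn_ge0// invr_ge0.
have [As AA] : (forall k, power_series_on a r (A k) (s * (1 - 2^-1 ^+ k))) /\
    (forall k, power_series_on a r (fun x => A k.+1 x - A k x) (s * 2^-1 ^+ k.+1)).
  suff H k : power_series_on a r (A k) (s * (1 - 2^-1 ^+ k)) /\
      power_series_on a r (fun x => A k.+1 x - A k x) (s * 2^-1 ^+ k.+1).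
    by split=> k; have [] := H k.
  elim: k => [|k [IH1 IH2]].
    rewrite expr0 subrr mulr0 expr1; split; first exact: ps0 (ltW r0).
    by apply: ps_ext T0 => x _; rewrite subr0.
  have IH1' : power_series_on a r (A k.+1) (s * (1 - 2^-1 ^+ k.+1)).
    have := psD r0 IH1 IH2.
    rewrite (_ : _ + _ = s * (1 - 2^-1 ^+ k.+1)); last by rewrite exprS; field.
    by apply: ps_ext => x _; rewrite addrC subrK.
  split=> //.
  have le_s j : s * (1 - 2^-1 ^+ j) <= s by rewrite ler_piMr// gerBl.
  have := Tc _ _ _ (ps_le (le_s k.+1) IH1') (ps_le (le_s k) IH1) IH2.
  by rewrite (_ : _ / 2 = s * 2^-1 ^+ k.+2)// !exprS; field.
have geo (k m : nat) :
    \sum_(0 <= i < m) s * 2^-1 ^+ (k + i).+1 = s * (2^-1 ^+ k - 2^-1 ^+ (k + m)).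
  elim: m => [|m IH]; first by rewrite big_geq// addn0 subrr mulr0.
  by rewrite big_nat_recr//= IH !exprD !exprS !exprD; field.
pose L x := limn (fun k => A k x).
have cvL x : `|x - a| <= r -> (fun k => A k x) @ \oo --> L x.
  move=> xr; suff : cvgn (series (fun k => A k.+1 x - A k x)).
    move=> cv; suff : cvgn (fun k => A k x) by [].
    have -> : (fun k => A k x) = series (fun k => A k.+1 x - A k x).
      apply/funext => k; rewrite /series /= telescope_sumr// /A /=.
      by rewrite subr0.
    exact: cv.
  apply: normed_cvg; apply: nondecreasing_is_cvgn.
    by apply: nondecreasing_series => k _ _; exact: normr_ge0.
  exists s => _ [m _ <-]; rewrite /series /=.
  apply: (@le_trans _ _ (\sum_(0 <= i < m) s * 2^-1 ^+ (0 + i).+1)).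
    by apply: ler_sum => k _; apply: ps_bound (AA k) xr.
  by rewrite geo expr0 ler_piMr// gerBl.
have LA k : power_series_on a r (fun x => L x - A k x) (s * 2^-1 ^+ k).
  apply: (@ps_series _ _ a r (fun i x => A (k + i).+1 x - A (k + i) x)
    (fun i => s * 2^-1 ^+ (k + i).+1)) => //.
    by move=> m; rewrite geo ler_wpM2l// gerBl.
  move=> x xr; have cA : (fun m => A m x - A k x) @ \oo --> L x - A k x.
    by apply: cvgB (cvg_cst _); exact: cvL.
  rewrite -(cvg_shiftn k) in cA; apply: cvg_seq_ext cA => m /=.
  have -> : \sum_(0 <= i < m) (A (k + i).+1 x - A (k + i) x) = A (k + m) x - A k x.
    under eq_bigr do rewrite -addnS.
    by rewrite (telescope_sumr (fun i => A (k + i)%N x) (leq0n m)) addn0.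
  by rewrite addnC.
have Ls : power_series_on a r L s.
  have := LA 0; rewrite expr0 mulr1; apply: ps_ext => x _; exact: subr0.
exists L => // x xr; apply/eqP; rewrite -subr_eq0 -normr_le0.
have le k : `|T L x - L x| <= s * 2^-1 ^+ k.
  have le_s : s * (1 - 2^-1 ^+ k) <= s by rewrite ler_piMr// gerBl.
  have := ps_bound (Tc _ _ _ Ls (ps_le le_s (As k)) (LA k)) xr.
  have := ps_bound (LA k.+1) xr.
  have -> : T L x - L x = (T L x - T (A k) x) - (L x - A k.+1 x) by rewrite /A /=; ring.
  move=> h1 h2; apply: le_trans (ler_normB _ _) _; rewrite exprS in h1; lra.
have cv0 : (fun k => s * 2^-1 ^+ k) @ \oo --> (0 : R).
  rewrite -[X in _ --> X](mulr0 s); apply: cvgMr; apply: cvg_expr.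
  by rewrite ger0_norm ?invr_ge0// invf_lt1// ltr1n.
by rewrite -(cvg_lim _ cv0)//; apply: limr_ge; [apply/cvg_ex; exists 0|exact: nearW].
Qed.

End exponential_of_power_series.

(** * Analytic solution of the implicit equation near a point *)

Section implicit_exponential_sum.
Context {R : realType} {n : nat}.

Lemma nonneg_series_cvg (u : nat -> R) (M : R) : (forall k, 0 <= u k) ->
  (forall N, \sum_(0 <= k < N) u k <= M) ->
  cvgn (fun N => \sum_(0 <= k < N) u k).
Proof.
move=> u0 uM; apply: nondecreasing_is_cvgn.
  by apply/nondecreasing_seqP => k; rewrite big_nat_recr//= lerDl.
by exists M => _ [N _ <-].
Qed.

Lemma seq_cvg_le (u : nat -> R) (l M : R) : u @ \oo --> l ->
  (forall k, u k <= M) -> l <= M.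
Proof.
move=> ul uM; rewrite -(cvg_lim _ ul)//.
by apply: limr_le; [apply/cvg_ex; exists l|exact: nearW].
Qed.

(* Newton's map for sum_k q_k exp (m_k (h_k - t)) = 1, whose t-derivative at the
   center is - sum_k q_k m_k, is a contraction in the algebra of power series
   on a small ball. *)
Lemma implicit_exponential (a : 'rV[R]_n) (rho S : R) (q m H : nat -> R)
    (h : nat -> 'rV[R]_n -> R) :
  0 < rho -> (forall k, 0 <= q k) -> (forall k, 1 <= m k) ->
  (forall k, 0 <= H k) ->
  (forall k t, 0 < t <= 1 -> power_series_on a (t * rho) (h k) (t * H k)) ->
  (forall N, \sum_(0 <= k < N) q k * m k * expR (2 * (m k * (H k + rho))) <= S) ->
  (fun N => \sum_(0 <= k < N) q k) @ \oo --> (1 : R) ->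
  exists2 r, 0 < r <= rho & exists t M, power_series_on a r t M /\
    forall x, `|x - a| <= r ->
    (fun N => \sum_(0 <= k < N) q k * expR (m k * (h k x - t x))) @ \oo --> (1 : R).
Proof.
move=> rho0 q0 m1 H0 hH qS q1.
pose X k := m k * (H k + rho).
have m0 k : 0 <= m k by apply: le_trans (m1 k).
have X0 k : 0 <= X k by rewrite mulr_ge0// addr_ge0// ltW.
have eX k : 1 <= expR (2 * X k).
  by apply: le_trans (expR_ge1Dx _); rewrite lerDl mulr_ge0.
have qm0 k : 0 <= q k * m k by rewrite mulr_ge0.
have qm_le N : \sum_(0 <= k < N) q k * m k <= S.
  by apply: le_trans (qS N); apply: ler_sum => k _; rewrite ler_peMr ?eX ?qm0 ?q0 ?m1.
have [Q qQ] : exists Q : R, (fun N => \sum_(0 <= k < N) q k * m k) @ \oo --> Q.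
  apply/cvg_ex. exact: (nonneg_series_cvg qm0 qm_le).
have QS : Q <= S := seq_cvg_le qQ qm_le.
have Q1 : 1 <= Q.
  apply: (seq_cvg_le q1) => N; apply: (@le_trans _ _ (\sum_(0 <= k < N) q k * m k)).
    by apply: ler_sum => k _; rewrite ler_peMr ?eX ?qm0 ?q0 ?m1.
  rewrite -(cvg_lim _ qQ)//.
  apply: (@nondecreasing_cvgn_le _ (fun N => \sum_(0 <= k < N) q k * m k)).
    by apply/nondecreasing_seqP => k; rewrite big_nat_recr//= lerDl.
  by apply/cvg_ex; exists Q.
have Q0 : 0 < Q by apply: lt_le_trans Q1.
have S0 : 0 < S by apply: lt_le_trans QS.
pose c := Q^-1; have c0 : 0 < c by rewrite invr_gt0.
(* Exponents shrunk by [th] give the Lipschitz constant [c * S * th], which this choice makes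
   1/2. *)
pose th := Q / (2 * S).
have th0 : 0 < th by rewrite divr_gt0// mulr_gt0.
have th1 : th <= 1 / 2.
  by rewrite /th ler_pdivrMr ?mulr_gt0//; lra.
have cS : c * S * th = 1 / 2 by rewrite /c /th; field; rewrite !gt_eqF.
pose s := th * rho; have s0 : 0 < s by rewrite mulr_gt0.
(* The ball shrinks further so that the first Newton step, of norm at most [c * S * th'], is at most
   [s / 2]. *)
pose th' := th * Num.min 1 s.
have th'0 : 0 < th' by rewrite mulr_gt0// lt_min ltr01 s0.
have th'th : th' <= th by rewrite ger_pMr// ge_min lexx.
have th's : th' <= th * s by rewrite ler_pM2l// ge_min lexx orbT.
pose r := th' * rho; have r0 : 0 < r by rewrite mulr_gt0.
have th'1 : 0 < th' <= 1 by rewrite th'0; lra.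
pose E k (t : 'rV[R]_n -> R) x := m k * (h k x - t x).
have Eps k t M : power_series_on a r t M ->
    power_series_on a r (E k t) (m k * (th' * H k + M)).
  move=> tM; have := psZ (m k) r0 (psB r0 (hH k th' th'1) tM).
  by rewrite (ger0_norm (m0 k)).
have EX k t : power_series_on a r t s -> power_series_on a r (E k t) (th * X k).
  move=> ts; apply: ps_le (Eps k t _ ts).
  rewrite /X mulrCA ler_wpM2l// mulrDr lerD2r ler_wpM2r//.
have Ecv t x : power_series_on a r t s -> `|x - a| <= r ->
    (fun N => \sum_(0 <= k < N) q k * expR (E k t x)) @ \oo -->
    limn (fun N => \sum_(0 <= k < N) q k * expR (E k t x)).
  move=> ts xr; apply: (@nonneg_series_cvg _ S).
    by move=> k; rewrite mulr_ge0// expR_ge0.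
  move=> N; apply: le_trans (qS N); apply: ler_sum => k _.
  rewrite -mulrA ler_wpM2l//; apply: (@le_trans _ _ (expR (2 * X k))).
    rewrite ler_expR; apply: le_trans (ler_norm _) _.
    apply: le_trans (ps_bound (EX k t ts) xr) _.
    by rewrite ler_wpM2r//; lra.
  by rewrite ler_peMl// expR_ge0.
pose T (t : 'rV[R]_n -> R) x := t x +
  c * (limn (fun N => \sum_(0 <= k < N) q k * expR (E k t x)) - 1).
(* The norm of exp minus 1 costs an extra factor [X k]; the 2 in the exponent of the hypothesis on
   [S] pays for it. *)
have Xexp k : X k * expR (X k) <= expR (2 * X k).
  rewrite mulr_natl mulr2n expRD ler_wpM2r ?expR_ge0//.
  by apply: le_trans (expR_ge1Dx _); rewrite lerDr.
have [||t ts tT] := @ps_picard R n a r s T r0.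
- have Z : power_series_on a r (fun=> 0) s by exact: ps_le (ltW s0) (ps0 a (ltW r0)).
  apply: (@ps_series _ _ a r (fun k x => c * (q k * (expR (E k (fun=> 0) x) - 1)))
    (fun k => c * (q k * (th' * (m k * expR (2 * X k)))))) => //.
  + move=> k.
    have := psZ c r0 (psZ (q k) r0 (ps_exp_sub1 r0 (Eps k _ _ (ps0 a (ltW r0))))).
    rewrite (ger0_norm (q0 k)) (gtr0_norm c0); apply: ps_le.
    rewrite ler_wpM2l ?(ltW c0)// ler_wpM2l// addr0 mulrCA -mulrA ler_wpM2l ?(ltW th'0)//.
    have hX : m k * H k <= X k by rewrite /X ler_wpM2l// lerDl ltW.
    have hX' : m k * (th' * H k) <= X k.
      apply: le_trans hX; rewrite mulrCA ler_piMl ?mulr_ge0//.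
      by case/andP: th'1.
    apply: (@le_trans _ _ (X k * expR (X k))).
      apply: ler_pM; rewrite ?expR_ge0 ?ler_expR//; last by rewrite mulrCA.
      by rewrite mulr_ge0.
    apply: le_trans (Xexp k) _; rewrite ler_peMl// expR_ge0.
  + move=> N; rewrite -mulr_sumr.
    under eq_bigr do rewrite mulrCA [q _ * _]mulrA.
    rewrite -mulr_sumr; apply: (@le_trans _ _ (c * (th' * S))).
      by rewrite ler_wpM2l ?(ltW c0)// ler_wpM2l ?(ltW th'0)//.
    have : c * S * th' <= 1 / 2 * s by rewrite -cS -[leRHS]mulrA ler_pM2l// mulr_gt0.
    lra.
  + move=> x xr; have cv := Ecv _ x Z xr.
    have cvT : (fun N => c * (\sum_(0 <= k < N) q k * expR (E k (fun=> 0) x) -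
        \sum_(0 <= k < N) q k)) @ \oo --> T (fun=> 0) x.
      by rewrite /T add0r; apply: cvgMr; exact: cvgB.
    apply: cvg_seq_ext cvT => N; rewrite -sumrB mulr_sumr.
    by apply: eq_bigr => k _; ring.
- move=> A B d As Bs ABd; have d0 := ps_ge0 (ltW r0) ABd.
  (* The linear terms cancel because [c * Q = 1]; what remains of [T A - T B] are the remainders
     estimated in [ps_exp_sub]. *)
  apply: (@ps_series _ _ a r (fun k x => c * (q k *
     (expR (E k A x) - expR (E k B x) - (E k A x - E k B x))))
    (fun k => c * (q k * (m k * d * (th * expR (2 * X k)))))) => //.
  + move=> k.
    have ABk : power_series_on a r (fun x => E k A x - E k B x) (m k * d).
      have := psZ (- m k) r0 ABd; rewrite normrN (ger0_norm (m0 k)).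
      by apply: ps_ext => x _; rewrite /E; ring.
    have := psZ c r0 (psZ (q k) r0 (ps_exp_sub r0 (EX k _ As) (EX k _ Bs) ABk)).
    rewrite (ger0_norm (q0 k)) (gtr0_norm c0); apply: ps_le.
    rewrite ler_wpM2l ?(ltW c0)// ler_wpM2l// ler_wpM2l// ?mulr_ge0//.
    apply: le_trans (expR_sub1_le _ _) _; first by rewrite ltW//; lra.
    rewrite ler_pM2l//; apply: (@le_trans _ _ (expR (X k))); first by rewrite gerBl.
    by rewrite ler_expR ler_peMl// ler1n.
  + move=> N; rewrite -mulr_sumr.
    have -> : \sum_(0 <= k < N) q k * (m k * d * (th * expR (2 * X k))) =
        d * th * \sum_(0 <= k < N) q k * m k * expR (2 * X k).
      by rewrite mulr_sumr; apply: eq_bigr => k _; ring.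
    apply: (@le_trans _ _ (c * (d * th * S))).
      rewrite ler_wpM2l ?(ltW c0)//; apply: ler_wpM2l (qS N).
      by rewrite mulr_ge0// ltW.
    have := congr1 (fun y => d * y) cS; lra.
  + move=> x xr; have cA := Ecv _ x As xr; have cB := Ecv _ x Bs xr.
    have cvT : (fun N => c * (\sum_(0 <= k < N) q k * expR (E k A x) -
        \sum_(0 <= k < N) q k * expR (E k B x) +
        (A x - B x) * (\sum_(0 <= k < N) q k * m k))) @ \oo --> T A x - T B x.
      rewrite (_ : T A x - T B x = c * (limn (fun N => \sum_(0 <= k < N) q k * expR (E k A x)) -
        limn (fun N => \sum_(0 <= k < N) q k * expR (E k B x)) + (A x - B x) * Q)).
        by apply: cvgMr; apply: cvgD; [exact: cvgB|exact: cvgMr].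
      by rewrite /T /c; field; rewrite gt_eqF.
    apply: cvg_seq_ext cvT => N; rewrite mulr_sumr -sumrB -big_split/= mulr_sumr.
    by apply: eq_bigr => k _; rewrite /E; ring.
- exists r; first by rewrite r0 ger_pMl//; case/andP: th'1.
  exists t, s; split=> // x xr.
  have := Ecv t x ts xr; have := tT x xr; rewrite /T => /eqP.
  rewrite -subr_eq0 addrAC subrr add0r mulf_eq0 (gt_eqF c0) /= subr_eq0.
  by move=> /eqP ->.
Qed.

End implicit_exponential_sum.

(** * Linear forms and the norm dual to the sup norm *)

Section linear_forms.
Context {R : realType} {n : nat}.
Implicit Types (p x y : 'rV[R]_n).

Definition dotv p x : R := \sum_(i < n) p ord0 i * x ord0 i.

Lemma dotvD p x y : dotv p (x + y) = dotv p x + dotv p y.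
Proof. by rewrite /dotv -big_split /=; apply: eq_bigr => i _; rewrite mxE mulrDr. Qed.

Lemma dotvZ p c x : dotv p (c *: x) = c * dotv p x.
Proof. by rewrite /dotv mulr_sumr; apply: eq_bigr => i _; rewrite mxE mulrCA. Qed.

Lemma dotvN p x : dotv p (- x) = - dotv p x.
Proof. by rewrite -scaleN1r dotvZ mulN1r. Qed.

Lemma dotvB p x y : dotv p (x - y) = dotv p x - dotv p y.
Proof. by rewrite dotvD dotvN. Qed.

Lemma dotv0 p : dotv p 0 = 0.
Proof. by rewrite -(subrr 0) dotvB subrr. Qed.

Lemma dotvDl p q x : dotv (p + q) x = dotv p x + dotv q x.
Proof. by rewrite /dotv -big_split /=; apply: eq_bigr => i _; rewrite mxE mulrDl. Qed.

Lemma dotvZl p c x : dotv (c *: p) x = c * dotv p x.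
Proof. by rewrite /dotv mulr_sumr; apply: eq_bigr => i _; rewrite mxE mulrA. Qed.

Lemma dotvNl p x : dotv (- p) x = - dotv p x.
Proof. by rewrite -scaleN1r dotvZl mulN1r. Qed.

Lemma dotvBl p q x : dotv (p - q) x = dotv p x - dotv q x.
Proof. by rewrite dotvDl dotvNl. Qed.

Definition dual_norm p : R := \sum_(i < n) `|p ord0 i|.

Lemma dual_norm_ge0 p : 0 <= dual_norm p.
Proof. exact: sumr_ge0. Qed.

Lemma dotv_le p x : `|dotv p x| <= dual_norm p * `|x|.
Proof.
rewrite /dual_norm mulr_suml; apply: le_trans (ler_norm_sum _ _ _) _.
by apply: ler_sum => i _; rewrite normrM ler_wpM2l// coord_le_norm.
Qed.

(** The maximizer is a scaled vector of signs. It converts an upper bound for an affine function on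
    a ball into one for its slope. *)
Lemma dotv_attained p r : 0 <= r ->
  exists2 x, `|x| <= r & dotv p x = r * dual_norm p.
Proof.
move=> r0; exists (\row_i (r * Num.sg (p ord0 i))).
  rewrite [leLHS]/Num.Def.normr /= mx_normrE; apply/bigmax_leP; split=> // -[i j] _ /=.
  rewrite mxE normrM (ger0_norm r0) normr_sg ler_piMr// lern1.
  by case: (_ != _).
rewrite /dotv /dual_norm mulr_sumr; apply: eq_bigr => i _.
by rewrite mxE mulrCA [p _ _ * _]mulrC -normrEsg.
Qed.

Lemma ps_dotv a r p : 0 < r ->
  power_series_on a r (fun x => dotv p (x - a)) (r * dual_norm p).
Proof.
move=> r0; rewrite /dual_norm mulr_sumr.
under eq_bigr do rewrite mulrC.
by apply: ps_sum => // i; apply: psZ => //; apply: ps_coord.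
Qed.

End linear_forms.

(** * The analytic convex function attached to an affine family *)

Section analytic_approximation.
Context {R : realType} {n : nat}.

Lemma convex_combE (t : {i01 R}) (x y : 'rV[R]_n) :
  conv t (x : convex_lmodType 'rV[R]_n) y = t%:num *: x + (1 - t%:num) *: y.
Proof. by []. Qed.

Lemma geometric_sum_le (z : R) N : 0 <= z < 1 ->
  \sum_(0 <= k < N) z ^+ k <= (1 - z)^-1.
Proof.
move=> /andP[z0 z1]; have z1' : 0 < 1 - z by rewrite subr_gt0.
suff -> : \sum_(0 <= k < N) z ^+ k = (1 - z ^+ N) / (1 - z).
  by rewrite ler_pdivrMr// mulVf ?gt_eqF// gerBl exprn_ge0.
elim: N => [|N IH]; first by rewrite big_geq// expr0 subrr mul0r.
by rewrite big_nat_recr//= IH exprS; field; rewrite gt_eqF.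
Qed.

(** [g x] is an infimum of admissible levels rather than a root: its bounds and its convexity follow
    from partial sums alone. Near a point, the gap gives convergence slightly below [g a]; only
    there is the sum shown to be exactly 1, as the implicit equation requires. *)
Lemma analytic_from_affine (U : set 'rV[R]_n) (f : 'rV[R]_n -> R) (e : R)
    (P : nat -> 'rV[R]_n) (b : nat -> R) : 0 < e ->
  let l k x := b k + dotv (P k) x in
  (forall k x, U x -> l k x <= f x - e / 2) ->
  (forall x, U x -> exists k, f x - e <= l k x) ->
  (forall a, U a -> exists i r eta k0, [/\ 0 < r, 0 < eta &
    forall k x, (k0 <= k)%N -> `|x - a| <= r -> l k x <= l i a - eta]) ->
  convex_set U ->
  exists g, [/\ real_analytic_on U g, convex_function U g
    & forall x, U x -> f x - e <= g x <= f x].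
Proof.
move=> e0 l lf fl gap Uconv.
(* Since [be * (e / 2) = e / 2 + 1], at level [f x] the k-th term is at most exp (-(k+2)), so the
   partial sums stay below 1/2. *)
pose be := 1 + 2 / e.
pose m (k : nat) : R := be * k.+2%:R.
have be1 : 1 <= be by rewrite lerDl divr_ge0// ltW.
have be0 : 0 < be by apply: lt_le_trans be1.
have mk k : k.+2%:R <= m k by rewrite ler_peMl.
have m1 k : 1 <= m k by apply: le_trans (mk k); rewrite ler1n.
have m0 k : 0 < m k by apply: lt_le_trans (m1 k).
pose F N x t := \sum_(0 <= k < N) expR (m k * (l k x - t)).
pose S x := [set t | forall N, F N x t <= 1].
have F_term k x t : S x t -> expR (m k * (l k x - t)) <= 1.
  move=> /(_ k.+1); apply: le_trans; rewrite /F big_nat_recr//= lerDr.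
  by apply: sumr_ge0 => i _; exact: expR_ge0.
have S_lb k x t : S x t -> l k x <= t.
  by move=> /(F_term k); rewrite expR_le1 pmulr_rle0// subr_le0.
have S_lbound x : lbound (S x) (l 0%N x) by move=> t /S_lb.
have S_up x t t' : t <= t' -> S x t -> S x t'.
  move=> tt' St N; apply: le_trans (St N); apply: ler_sum => k _.
  by rewrite ler_expR ler_pM2l// lerB.
have half : expR (- 1) <= 1 / 2 :> R.
  rewrite expRN div1r lef_pV2 ?posrE ?expR_gt0//.
  exact: expR_ge1Dx.
have Sf x : U x -> S x (f x).
  move=> Ux N; apply: (@le_trans _ _ (\sum_(0 <= k < N) 1 / 2 * (1 / 2) ^+ k.+1)).
    apply: ler_sum => k _; rewrite -exprS.
    apply: (@le_trans _ _ (expR (- 1) ^+ k.+2)); last first.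
      by apply: lerXn2r; rewrite ?nnegrE ?expR_ge0.
    rewrite -expRM_natl ler_expR mulrN1.
    have h1 : l k x - f x <= - (e / 2) by have := lf k x Ux; lra.
    apply: le_trans (ler_wpM2l (ltW (m0 k)) h1) _.
    rewrite mulrN lerN2 /m /be mulrC mulrA ler_peMl//.
    have -> : e / 2 * (1 + 2 / e) = e / 2 + 1 by field; rewrite gt_eqF.
    by rewrite lerDr divr_ge0// ltW.
  rewrite -mulr_sumr; under eq_bigr do rewrite exprS.
  rewrite -mulr_sumr; have := @geometric_sum_le (1 / 2) N.
  rewrite (_ : (1 - 1 / 2)^-1 = 2 :> R); last by field.
  have h01 : 0 <= (1 / 2 : R) < 1 by apply/andP; split; lra.
  by move=> /(_ h01); lra.
pose g x := inf (S x).
have g_lb k x t : S x t -> l k x <= g x.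
  move=> St; apply: lb_le_inf; first by exists t.
  by move=> t' /S_lb.
have g_le x t : S x t -> g x <= t.
  by move=> St; apply: ge_inf => //; exists (l 0%N x).
have Sg x t : S x t -> S x (g x).
  move=> St N; rewrite leNgt; apply/negP => F1.
  set s := F N x (g x) in F1.
  have s0 : 0 < s by apply: lt_trans F1.
  (* Raising the level by [d] multiplies each of the first [N] terms by at least [1 - m N * d],
     which leaves at least [(s + 1) / 2 > 1]; so the infimum is attained. *)
  pose d := (s - 1) / (2 * m N * s).
  have d0 : 0 < d by rewrite divr_gt0 ?subr_gt0// !mulr_gt0.
  have [t' St' t'd] : exists2 t', S x t' & t' < g x + d.
    by apply: inf_adherent => //; split; [exists t|exists (l 0%N x)].
  have Sd := S_up _ _ _ (ltW t'd) St' N.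
  have : s * (1 - m N * d) <= F N x (g x + d).
    rewrite /s /F mulr_suml; apply: ler_sum_nat => k /andP[_ kN].
    have -> : m k * (l k x - (g x + d)) = m k * (l k x - g x) + - (m k * d) by ring.
    rewrite expRD ler_pM2l ?expR_gt0//.
    apply: le_trans (expR_ge1Dx _); rewrite lerD2l lerN2 ler_pM2r// ler_pM2l// ler_nat.
    by rewrite !ltnS ltnW.
  have -> : s * (1 - m N * d) = (s + 1) / 2 by rewrite /d; field; rewrite !gt_eqF.
  by move=> /le_trans/(_ Sd); lra.
exists g; split.
- apply: power_series_real_analytic => a Ua.
  have [i [r [eta [k0 [r0 eta0 far]]]]] := gap a Ua.
  have Sga := Sg a _ (Sf a Ua).
  pose t0 := g a; have lt0 : l i a <= t0 := g_lb i a _ (Sf a Ua).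
  (* [2 * rho <= r] bounds [2 * H k] by the variation of [l k] on the given ball, and
     [4 * rho <= eta] saves half of the gap when the level drops by [2 * rho]. *)
  pose rho := Num.min (r / 2) (eta / 4).
  have rho0 : 0 < rho by rewrite lt_min !divr_gt0.
  have rho_r : 2 * rho <= r by rewrite mulrC -ler_pdivlMr// ge_min lexx.
  have rho_eta : rho <= eta / 4 by rewrite ge_min lexx orbT.
  pose q k := expR (m k * (l k a - t0)).
  pose H k := rho * dual_norm (P k).
  have H0 k : 0 <= H k by rewrite mulr_ge0 ?dual_norm_ge0// ltW.
  pose term k := q k * m k * expR (2 * (m k * (H k + rho))).
  have term0 k : 0 <= term k by rewrite !mulr_ge0 ?expR_ge0// ltW.
  pose z := expR (- (eta / 4)).
  have z01 : 0 <= z < 1 by rewrite expR_ge0 expR_lt1 oppr_lt0 divr_gt0.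
  have term_far k : (k0 <= k)%N -> term k <= 4 / eta * z ^+ k.
    move=> k0k; have [y yr yP] := dotv_attained (P k) (ltW r0).
    have := far k (a + y) k0k; rewrite addrAC subrr add0r => /(_ yr).
    rewrite {1}/l dotvD addrA yP -/(l k a) => lk.
    have rP : 2 * H k <= r * dual_norm (P k).
      by rewrite /H mulrA ler_wpM2r ?dual_norm_ge0.
    have lk' : l k a - t0 + 2 * (H k + rho) <= - (eta / 2) by lra.
    have -> : term k = m k * expR (m k * (l k a - t0 + 2 * (H k + rho))).
      by rewrite /term /q mulrAC -expRD mulrC; congr (_ * expR _); ring.
    (* Half of the decay absorbs the factor [m k], since m exp (- m eta / 4) <= 4 / eta; the other
       half gives the geometric tail. *)
    apply: (@le_trans _ _ (m k * (expR (- (m k * (eta / 4))) * expR (- (m k * (eta / 4)))))).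
      rewrite ler_pM2l// -expRD ler_expR.
      have := ler_wpM2l (ltW (m0 k)) lk'; lra.
    rewrite mulrA; apply: ler_pM; rewrite ?expR_ge0//.
      by rewrite mulr_ge0 ?expR_ge0// ltW.
      rewrite expRN ler_pdivrMr ?expR_gt0// -ler_pdivrMl ?divr_gt0// invf_div mulrC.
      by rewrite -mulrA; apply: le_trans (expR_ge1Dx _); rewrite mulrA lerDr.
    rewrite /z -expRM_natl ler_expR mulrN lerN2 ler_pM2r ?divr_gt0//.
    by apply: le_trans (mk k); rewrite ler_nat leqW.
  pose T := 1 + \sum_(0 <= k < k0) term k + 4 / eta * (1 - z)^-1.
  have termT N : \sum_(0 <= k < N) term k <= T.
    apply: (@le_trans _ _ (\sum_(0 <= k < k0 + N) term k)).
      rewrite addnC (big_cat_nat _ (leq_addr k0 N))//= lerDl.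
      by apply: sumr_ge0 => k _.
    rewrite (big_cat_nat _ (leq_addr N k0))//=.
    rewrite /T -addrA [leRHS]addrC -addrA lerD2l.
    apply: (@le_trans _ _ (4 / eta * \sum_(k0 <= k < k0 + N) z ^+ k)).
      by rewrite mulr_sumr; apply: ler_sum_nat => k /andP[k0k _]; exact: term_far.
    rewrite -[leLHS]addr0; apply: lerD => //; rewrite ler_pM2l ?divr_gt0//.
    apply: le_trans (geometric_sum_le (k0 + N) z01).
    rewrite [leRHS](big_cat_nat _ (leq_addr N k0))//= lerDr.
    by apply: sumr_ge0 => k _; rewrite exprn_ge0//; case/andP: z01.
  have T0 : 0 < T by apply: lt_le_trans ltr01 _; rewrite /T -addrA lerDl addr_ge0//
    ?sumr_ge0// mulr_ge0 ?divr_ge0 ?invr_ge0 ?subr_ge0 ?ltW//; case/andP: z01.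
  have q0 k : 0 <= q k by exact: expR_ge0.
  have [s qs] : exists s : R, (fun N => \sum_(0 <= k < N) q k) @ \oo --> s.
    by apply/cvg_ex; exact: (nonneg_series_cvg q0 Sga).
  have q_le N : \sum_(0 <= k < N) q k <= s.
    rewrite -(cvg_lim _ qs)//.
    apply: (@nondecreasing_cvgn_le _ (fun N => \sum_(0 <= k < N) q k)).
      by apply/nondecreasing_seqP => k; rewrite big_nat_recr//= lerDl.
    by apply/cvg_ex; exists s.
  have s1 : s <= 1 := seq_cvg_le qs Sga.
  (* A sum below 1 leaves room to lower the level: going down by [d * rho] raises the sum by at most
     [d * T <= 1 - s], against the minimality of [t0]. *)
  have s1E : s = 1.
    apply/eqP; rewrite eq_le s1 leNgt; apply/negP => s_lt1.
    pose d := Num.min 1 ((1 - s) / T).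
    have d0 : 0 < d by rewrite lt_min ltr01 divr_gt0// subr_gt0.
    have d1 : 0 <= d <= 1 by rewrite ltW//= ge_min lexx.
    have dT : d * T <= 1 - s by rewrite -ler_pdivlMr// ge_min lexx orbT.
    suff : S a (t0 - d * rho).
      by move=> /g_le; rewrite -/t0 leNgt gtrBl mulr_gt0.
    move=> N; apply: (@le_trans _ _ (s + d * T)); last by lra.
    apply: (@le_trans _ _ (\sum_(0 <= k < N) (q k + d * term k))).
      apply: ler_sum => k _.
      have -> : m k * (l k a - (t0 - d * rho)) = m k * (l k a - t0) + d * (m k * rho) by ring.
      rewrite expRD -/(q k).
      have h1 := expR_sub1_le (m k * rho) d1.
      have h2 : expR (m k * rho) <= m k * expR (2 * (m k * (H k + rho))).
        apply: (@le_trans _ _ (expR (2 * (m k * (H k + rho))))); last first.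
          by rewrite ler_peMl ?expR_ge0.
        rewrite ler_expR mulrCA ler_pM2l//; have := H0 k; lra.
      have h3 : expR (d * (m k * rho)) <= 1 + d * (m k * expR (2 * (m k * (H k + rho)))).
        have := ler_wpM2l (ltW d0) h2; lra.
      have := ler_wpM2l (q0 k) h3; rewrite /term; lra.
    rewrite big_split /= -mulr_sumr; apply: lerD => //.
    by rewrite ler_wpM2l// ltW.
  rewrite s1E in qs.
  have [|r' /andP[r'0 r'rho] [t [M [tM tcv]]]] := @implicit_exponential R n a rho T q m H
    (fun k x => dotv (P k) (x - a)) rho0 q0 m1 H0 _ termT qs.
    move=> k th /andP[th0 _]; rewrite /H mulrA; apply: ps_dotv.
    exact: mulr_gt0.
  exists r' => //; exists (`|t0| + M).
  apply: ps_ext (psD r'0 (ps_cst a t0 r'0) tM) => x xr.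
  have Fcv : (fun N => F N x (t0 + t x)) @ \oo --> (1 : R).
    apply: cvg_seq_ext (tcv x xr) => N; apply: eq_bigr => k _.
    rewrite /q -expRD /l dotvB; congr expR; ring.
  have F_le N : F N x (t0 + t x) <= 1.
    rewrite -(cvg_lim _ Fcv)//.
    apply: (@nondecreasing_cvgn_le _ (fun N => F N x (t0 + t x))).
      by apply/nondecreasing_seqP => k; rewrite /F big_nat_recr//= lerDl expR_ge0.
    by apply/cvg_ex; exists 1.
  apply/eqP; rewrite eq_le andbC (g_le _ _ F_le) /=.
  apply: lb_le_inf; first by exists (t0 + t x).
  move=> t' St'; rewrite leNgt; apply/negP => t't.
  (* Lowering the level by [d] multiplies every term by at least [1 + d], because [m k >= 1]; the
     sum, equal to 1 at [t0 + t x], would exceed 1 at [t']. *)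
  pose d := t0 + t x - t'; have d0 : 0 < d by rewrite subr_gt0.
  have d1 : 0 < 1 + d := addr_gt0 ltr01 d0.
  have : 1 <= (1 + d)^-1.
    apply: (seq_cvg_le Fcv) => N; rewrite -[leRHS]mul1r ler_pdivlMr//.
    apply: le_trans (St' N); rewrite /F mulr_suml; apply: ler_sum => k _.
    have -> : m k * (l k x - t') = m k * (l k x - (t0 + t x)) + m k * d by rewrite /d; ring.
    rewrite expRD ler_pM2l ?expR_gt0//; apply: le_trans (expR_ge1Dx _).
    by rewrite lerD2l ler_peMl// ltW.
  by rewrite leNgt invf_lt1// ltrDl d0.
- move=> t x y; rewrite !inE => Ux Uy; apply: g_le => N.
  have tx0 : 0 <= t%:num by exact: ge0.
  have tx1 : 0 <= 1 - t%:num by rewrite subr_ge0; exact: le1.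
  set tx := t%:num in tx0 tx1.
  have Sx := Sg x _ (Sf x Ux) N; have Sy := Sg y _ (Sf y Uy) N.
  apply: (@le_trans _ _ (tx * F N x (g x) + (1 - tx) * F N y (g y))); last first.
    apply: le_trans (lerD (ler_wpM2l tx0 Sx) (ler_wpM2l tx1 Sy)) _.
    by rewrite !mulr1 addrC subrK.
  rewrite /F !mulr_sumr -big_split /=; apply: ler_sum => k _.
  set u := m k * (l k x - g x); set v := m k * (l k y - g y).
  have -> : m k * (l k (conv t x y) - conv t (g x : R^o) (g y)) = tx * u + (1 - tx) * v.
    have -> : conv t (g x : R^o) (g y) = tx * g x + (1 - tx) * g y by [].
    by rewrite convex_combE -/tx /l dotvD !dotvZ /u /v /l; ring.
  set w := tx * u + _.
  (* Jensen's inequality for exp, from its tangent at the averaged exponent [w]. *)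
  have tangent c : expR w * (1 + (c - w)) <= expR c.
    have -> : expR c = expR w * expR (c - w) by rewrite -expRD addrC subrK.
    by rewrite ler_pM2l ?expR_gt0// expR_ge1Dx.
  apply: le_trans (lerD (ler_wpM2l tx0 (tangent u)) (ler_wpM2l tx1 (tangent v))).
  set E := expR w; rewrite le_eqVlt; apply/orP; left; apply/eqP.
  by rewrite /w; ring.
- move=> x Ux; rewrite g_le ?andbT; last exact: Sf.
  have [k] := fl x Ux; move/le_trans; apply.
  exact: g_lb (Sf x Ux).
Qed.

End analytic_approximation.

(** * Local bounds and subgradients of convex functions *)

Section convex_functions.
Context {R : realType} {n : nat}.
Implicit Types (U : set 'rV[R]_n) (f : 'rV[R]_n -> R) (a x y : 'rV[R]_n).

Lemma convex_set_comb U x y (t : R) : convex_set U -> 0 <= t <= 1 ->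
  U x -> U y -> U (t *: x + (1 - t) *: y).
Proof.
move=> cU /andP[t0 t1] Ux Uy; have := cU x y (Itv01 t0 t1).
by rewrite !inE => /(_ Ux Uy).
Qed.

Lemma convex_function_comb U f x y (t : R) : convex_function U f -> 0 <= t <= 1 ->
  U x -> U y -> f (t *: x + (1 - t) *: y) <= t * f x + (1 - t) * f y.
Proof.
move=> cf /andP[t0 t1] Ux Uy; have := cf (Itv01 t0 t1) x y.
by rewrite !inE => /(_ Ux Uy).
Qed.

Lemma open_closed_ball U a : open U -> U a ->
  exists2 r, 0 < r & forall x, `|x - a| <= r -> U x.
Proof.
move=> oU Ua; have /nbhs_ballP[r /= r0 rU] : nbhs a U by exact: open_nbhs_nbhs.
exists (r / 2); first by rewrite divr_gt0.
move=> x xr; apply: rU; rewrite -ball_normE /= distrC.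
by apply: le_lt_trans xr _; rewrite ltr_pdivrMr// ltr_pMr// ltr1n.
Qed.

Definition supported_below (k : nat) x := forall i : 'I_n, (k <= i)%N -> x ord0 i = 0.

Lemma norm_delta (i : 'I_n) (s : R) : `|s *: delta_mx ord0 i : 'rV[R]_n| <= `|s|.
Proof.
rewrite [leLHS]/Num.Def.normr /= mx_normrE; apply/bigmax_leP; split=> // -[u j] _ /=.
rewrite !mxE; case: (_ && _); first by rewrite mulr1.
by rewrite mulr0 normr0.
Qed.

Lemma norm_le_coord x (r : R) : 0 <= r -> (forall i, `|x ord0 i| <= r) -> `|x| <= r.
Proof.
move=> r0 xr; rewrite [leLHS]/Num.Def.normr /= mx_normrE.
by apply/bigmax_leP; split=> // -[u j] _ /=; rewrite ord1.
Qed.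

(** Induction on the coordinates: [a + v] is the midpoint of two points, one displaced from [a] by
    twice the part of [v] in the first k coordinates, the other by twice its next component. The
    first is bounded by induction, the second by the endpoints of a segment. *)
Lemma convex_locally_bounded U f a : open U -> convex_set U ->
  convex_function U f -> U a ->
  exists r B, 0 < r /\ forall v, `|v| <= r -> U (a + v) /\ f (a + v) <= B.
Proof.
move=> oU cU cf Ua; have [r0 r00 r0U] := open_closed_ball oU Ua.
have step k : exists r B, 0 < r /\ forall v, supported_below k v -> `|v| <= r ->
    U (a + v) /\ f (a + v) <= B.
  elim: k => [|k [r [B [r_gt0 rB]]]].
    exists 1, (f a); split=> // v v0 _.
    have -> : v = 0 by apply/rowP => i; rewrite v0// mxE.
    by rewrite addr0.
  have [nk|kn] := leqP n k.
    exists r, B; split=> // v vk; apply: rB => i ki.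
    by have := leq_trans nk ki; rewrite leqNgt ltn_ord.
  pose e : 'rV[R]_n := delta_mx ord0 (Ordinal kn).
  have ae s : `|s| <= r0 -> U (a + s *: e).
    move=> sr; apply: r0U; rewrite addrAC subrr add0r.
    exact: le_trans (norm_delta _ _) sr.
  have Up : U (a + r0 *: e) by apply: ae; rewrite gtr0_norm.
  have Um : U (a + (- r0) *: e) by apply: ae; rewrite normrN gtr0_norm.
  pose C := Num.max (f (a + r0 *: e)) (f (a + (- r0) *: e)).
  have fe s : `|s| <= r0 -> f (a + s *: e) <= C.
    rewrite ler_norml => /andP[s1 s2]; pose t := (s + r0) / (2 * r0).
    have t01 : 0 <= t <= 1.
      rewrite divr_ge0 ?mulr_ge0// ?(ltW r00)//; last by lra.
      by rewrite ler_pdivrMr ?mulr_gt0//; lra.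
    have -> : a + s *: e = t *: (a + r0 *: e) + (1 - t) *: (a + (- r0) *: e).
      rewrite !scalerDr addrACA -scalerDl [t + _]addrC subrK scale1r; congr (_ + _).
      rewrite !scalerA -scalerDl; congr (_ *: _).
      by rewrite /t; field; rewrite gt_eqF.
    apply: le_trans (convex_function_comb cf t01 Up Um) _.
    case/andP: t01 => t0 t1; apply: (@le_trans _ _ (t * C + (1 - t) * C)); last by lra.
    by apply: lerD; rewrite ler_wpM2l ?subr_ge0// le_max lexx ?orbT.
  exists (Num.min (r / 2) (r0 / 2)), (Num.max B C).
  split; first by rewrite lt_min !divr_gt0.
  move=> v vk; rewrite le_min => /andP[vr vr0].
  pose s := v ord0 (Ordinal kn); pose v' := v - s *: e.
  have v'k : supported_below k (2 *: v').
    move=> i; rewrite leq_eqVlt !mxE /= => /orP[/eqP ki|ki].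
      have -> : i = Ordinal kn by exact: val_inj.
      by rewrite eqxx mulr1 subrr mulr0.
    rewrite vk// [_ == _](_ : _ = false) ?mulr0 ?subr0 ?mulr0//.
    by apply/negbTE; rewrite -val_eqE /= neq_ltn ki orbT.
  have [|U1 f1] := rB (2 *: v') v'k.
    apply: norm_le_coord (ltW r_gt0) _ => i; rewrite !mxE /=.
    have vi := le_trans (coord_le_norm v i) vr.
    have [->|ik] := eqVneq i (Ordinal kn).
      by rewrite mulr1 subrr mulr0 normr0 ltW.
    by rewrite mulr0 subr0 normrM ger0_norm//; lra.
  have s2 : `|2 * s| <= r0.
    have := le_trans (coord_le_norm v (Ordinal kn)) vr0.
    by rewrite normrM ger0_norm// -/s; lra.
  have U2 := ae _ s2; have f2 := fe _ s2.
  have h01 : 0 <= (1 / 2 : R) <= 1 by apply/andP; split; lra.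
  have -> : a + v = (1 / 2) *: (a + 2 *: v') + (1 - 1 / 2) *: (a + (2 * s) *: e).
    by apply/rowP => i; rewrite !mxE; field.
  split; first exact: convex_set_comb.
  apply: le_trans (convex_function_comb cf h01 U1 U2) _.
  rewrite le_max; have [BC|CB] := leP B C; apply/orP; [right|left]; lra.
have [r [B [r_gt0 rB]]] := step n; exists r, B; split=> // v; apply: rB => i.
by rewrite leqNgt ltn_ord.
Qed.

(** A point near [a] is a convex combination of [a] and a point where [f] is at most [B], with small
    weight on the latter. *)
Lemma convex_upper_semicontinuous U f a d : open U -> convex_set U ->
  convex_function U f -> U a -> 0 < d ->
  exists2 r, 0 < r & forall x, `|x - a| <= r -> U x /\ f x <= f a + d.
Proof.
move=> oU cU cf Ua d0; have [r [B [r0 rB]]] := convex_locally_bounded oU cU cf Ua.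
have faB : f a <= B by have := (rB 0 _).2; rewrite addr0 normr0; apply; exact: ltW.
pose t := Num.min 1 (d / (B - f a + 1)).
have Bf : 0 < B - f a + 1 by lra.
have t0 : 0 < t by rewrite lt_min ltr01 divr_gt0.
have t1 : t <= 1 by rewrite ge_min lexx.
have td : t * (B - f a + 1) <= d by rewrite -ler_pdivlMr// ge_min lexx orbT.
exists (t * r); first exact: mulr_gt0.
move=> x xr; have [|U1 f1] := rB (t^-1 *: (x - a)).
  by rewrite normrZ gtr0_norm ?invr_gt0// ler_pdivrMl.
have t01 : 0 <= t <= 1 by rewrite ltW.
have -> : x = t *: (a + t^-1 *: (x - a)) + (1 - t) *: a.
  rewrite scalerDr scalerA divff ?gt_eqF// scale1r addrAC -scalerDl addrC.
  by rewrite addrC [t + _]addrC subrK scale1r addrC subrK.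
split; first exact: convex_set_comb.
apply: le_trans (convex_function_comb cf t01 U1 Ua) _.
have := ler_wpM2l (ltW t0) f1; lra.
Qed.

(** Hahn-Banach, one coordinate at a time. The new slope is the supremum of the quotients on the
    negative side, which lie below those on the positive side; openness supplies points on both
    sides. *)
Lemma subgradient_exists U f a : open U -> convex_set U ->
  convex_function U f -> U a ->
  exists p, forall x, U x -> f a + dotv p (x - a) <= f x.
Proof.
move=> oU cU cf Ua; have [r0 r00 r0U] := open_closed_ball oU Ua.
have step k : exists p, supported_below k p /\
    forall w, supported_below k w -> U (a + w) -> f a + dotv p w <= f (a + w).
  elim: k => [|k [p [pk pf]]].
    exists 0; split=> [i _|w w0 _]; first by rewrite mxE.
    have -> : w = 0 by apply/rowP => i; rewrite w0// mxE.
    by rewrite addr0 dotv0 addr0.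
  have [nk|kn] := leqP n k.
    have sE w : supported_below k.+1 w -> supported_below k w.
      by move=> _ i ki; have := leq_trans nk ki; rewrite leqNgt ltn_ord.
    exists p; split=> [i ki|w /sE]; last exact: pf.
    by apply: pk; apply: ltnW.
  pose o := Ordinal kn; pose e : 'rV[R]_n := delta_mx ord0 o.
  have eE i : e ord0 i = (i == o)%:R by rewrite mxE.
  have neq_o (i : 'I_n) : (k < i)%N -> (i == o) = false.
    by move=> ki; apply/negbTE/negP => /eqP io; move: ki; rewrite io ltnn.
  pose phi w := f (a + w) - f a - dotv p w.
  pose A w := supported_below k.+1 w /\ U (a + w).
  have phi_ge0 w : A w -> w ord0 o = 0 -> 0 <= phi w.
    move=> [wk Uw] w0; rewrite /phi; have := pf w _ Uw.
    have wk' : supported_below k w.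
      move=> i; rewrite leq_eqVlt => /orP[/eqP ki|]; last exact: wk.
      by have -> : i = o by exact: val_inj.
    by move=> /(_ wk'); lra.
  have cross w w' : A w -> A w' -> w ord0 o < 0 -> 0 < w' ord0 o ->
      phi w / w ord0 o <= phi w' / w' ord0 o.
    move=> [wk Uw] [w'k Uw'] w0 w'0.
    set s := w ord0 o in w0 *; set s' := w' ord0 o in w'0 *.
    (* The weight for which the combination of [w] and [w'] has coordinate [o] equal to 0, where the
       form already found supports [f]. *)
    pose t := s' / (s' - s).
    have ss : 0 < s' - s by lra.
    have t01 : 0 <= t <= 1.
      apply/andP; split; first by rewrite divr_ge0// ltW.
      by rewrite ler_pdivrMr//; lra.
    have E : a + (t *: w + (1 - t) *: w') = t *: (a + w) + (1 - t) *: (a + w').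
      by rewrite !scalerDr addrACA -scalerDl [t + _]addrC subrK scale1r.
    have Um := convex_set_comb cU t01 Uw Uw'.
    have := convex_function_comb cf t01 Uw Uw'; rewrite -E => fm.
    have : 0 <= phi (t *: w + (1 - t) *: w').
      apply: phi_ge0; last by rewrite !mxE -/s -/s' /t; field; rewrite gt_eqF.
      split=> [i ki|]; last by rewrite E.
      by rewrite !mxE wk// w'k// !mulr0 addr0.
    rewrite {1}/phi dotvD !dotvZ => h.
    have : 0 <= t * phi w + (1 - t) * phi w' by rewrite /phi; lra.
    have -> : t * phi w + (1 - t) * phi w' =
        (s' * - s / (s' - s)) * (phi w' / s' - phi w / s).
      have sn : s != 0 by rewrite lt_eqF.
      have s'n : s' != 0 by rewrite gt_eqF.
      have ssn : s' - s != 0 by rewrite gt_eqF.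
      by rewrite /t; field; rewrite ?sn ?s'n ?ssn.
    by rewrite pmulr_rge0 ?subr_ge0// divr_gt0// mulr_gt0// oppr_gt0.
  have Ae s : `|s| <= r0 -> A (s *: e).
    move=> sr; split.
      by move=> i ki; rewrite mxE eE neq_o// mulr0.
    apply: r0U; rewrite addrAC subrr add0r.
    exact: le_trans (norm_delta _ _) sr.
  have eo s : (s *: e) ord0 o = s by rewrite mxE eE eqxx mulr1.
  have Ap : A (r0 *: e) by apply: Ae; rewrite gtr0_norm.
  have Am : A (- r0 *: e) by apply: Ae; rewrite normrN gtr0_norm.
  pose L := [set phi w / w ord0 o | w in [set w | A w /\ w ord0 o < 0]].
  have L0 : L !=set0.
    by exists (phi (- r0 *: e) / (- r0 *: e) ord0 o), (- r0 *: e); rewrite //= eo oppr_lt0.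
  have Lub w : A w -> 0 < w ord0 o -> ubound L (phi w / w ord0 o).
    by move=> Aw w0 _ [w' [Aw' w'0] <-]; exact: cross.
  pose c := sup L.
  exists (p + c *: e); split.
    by move=> i ki; rewrite mxE [X in _ + X]mxE eE (pk i (ltnW ki)) (neq_o i ki) mulr0 addr0.
  move=> w wk Uw; have Aw : A w := conj wk Uw.
  have -> : dotv (p + c *: e) w = dotv p w + c * w ord0 o.
    rewrite dotvDl dotvZl; congr (_ + c * _).
    rewrite /dotv (bigD1 o)//= big1 => [|i /negbTE io]; last by rewrite eE io mul0r.
    by rewrite eE eqxx mul1r addr0.
  suff : c * w ord0 o <= phi w by rewrite /phi; lra.
  have [w0|w0|w0] := ltgtP (w ord0 o) 0.
  - rewrite -ler_ndivrMr//; apply: ub_le_sup; last by exists w.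
    by exists (phi (r0 *: e) / (r0 *: e) ord0 o); apply: Lub => //; rewrite eo.
  - by rewrite -ler_pdivlMr//; apply: ge_sup => //; exact: Lub.
  - by rewrite w0 mulr0; exact: phi_ge0.
have [p [_ pf]] := step n; exists p => x Ux.
rewrite -{2}(subrK a x) [x - a + a]addrC; apply: pf; last by rewrite addrC subrK.
by move=> i; rewrite leqNgt ltn_ord.
Qed.

End convex_functions.

(** * Compact layers exhausting the domain *)

Section compact_exhaustion.
Context {R : realType} {n : nat}.
Variable U : set 'rV[R]_n.
Implicit Types x y : 'rV[R]_n.

(** Balls are used instead of the distance to the complement, so that [U] equal to the whole space
    is no special case. *)
Definition exhaust (j : nat) : set 'rV[R]_n :=
  [set x | `|x| <= j%:R /\ forall y, `|y - x| < j.+1%:R^-1 -> U y].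

(** The loss of margin between consecutive layers: a point outside layer [j.+1] is farther than this
    from every point of layer [j]. *)
Definition exhaust_gap (j : nat) : R := j.+1%:R^-1 - j.+2%:R^-1.

Lemma exhaust_gap_gt0 j : 0 < exhaust_gap j.
Proof. by rewrite subr_gt0 ltf_pV2 ?posrE// ltr_nat. Qed.

Lemma exhaust_sub j : exhaust j `<=` U.
Proof. by move=> x [_]; apply; rewrite subrr normr0 invr_gt0. Qed.

Lemma exhaust_near j x y : exhaust j x -> `|y - x| <= exhaust_gap j ->
  exhaust j.+1 y.
Proof.
move=> [xj xU] yx; split.
  have -> : y = x + (y - x) by rewrite addrC subrK.
  rewrite -natr1; apply: le_trans (ler_normD _ _) _; apply: lerD => //.
  apply: le_trans yx _; apply: (@le_trans _ _ j.+1%:R^-1).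
    by rewrite gerBl invr_ge0.
  by rewrite invf_le1// ler1n.
move=> z zy; apply: xU; rewrite -(subrK y z) -addrA.
apply: le_lt_trans (ler_normD _ _) _.
by apply: (lt_le_trans (ltr_leD zy yx)); rewrite addrC subrK.
Qed.

Lemma exhaust_interior j : exhaust j `<=` interior (exhaust j.+1).
Proof.
move=> x xj; apply/nbhs_ballP; exists (exhaust_gap j).
  exact: exhaust_gap_gt0.
move=> y; rewrite -ball_normE /= => xy; apply: exhaust_near xj _.
by rewrite distrC ltW.
Qed.

Lemma exhaust_mono i j : (i <= j)%N -> exhaust i `<=` exhaust j.
Proof.
move=> ij; have -> : j = (i + (j - i))%N by rewrite subnKC.
elim: (j - i)%N => [|k IH]; first by rewrite addn0.
apply: subset_trans IH _ => x xk; rewrite addnS.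
exact: (interior_subset (exhaust_interior xk)).
Qed.

Lemma exhaust_closed j : closed (exhaust j).
Proof.
move=> x clx.
have near_x r : 0 < r -> exists2 k, exhaust j k & `|x - k| < r.
  move=> r0; have [k [kj kx]] := clx _ (nbhsx_ballx x r r0).
  by exists k => //; move: kx; rewrite -ball_normE.
split.
  rewrite leNgt; apply/negP => jx.
  have [|k [kj _] xk] := near_x (`|x| - j%:R); first by rewrite subr_gt0.
  have := ler_normD k (x - k); rewrite addrC subrK; lra.
move=> y yx; have [|k [_ kU] xk] := near_x (j.+1%:R^-1 - `|y - x|).
  by rewrite subr_gt0.
apply: kU; rewrite -(subrK x y) -addrA; apply: le_lt_trans (ler_normD _ _) _.
by rewrite -ltrBrDl.
Qed.

Lemma exhaust_compact j : compact (exhaust j).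
Proof.
apply: bounded_closed_compact; last exact: exhaust_closed.
exists j%:R; split; first exact: num_real.
by move=> M jM x [xj _]; apply: le_trans xj (ltW jM).
Qed.

Lemma exhaust_cover x : open U -> U x -> exists j, exhaust j x.
Proof.
move=> oU Ux; have [r r0 rU] := open_closed_ball oU Ux.
pose j := Num.bound (`|x| + r^-1); exists j.
have xj : `|x| + r^-1 < j%:R by apply: archi_boundP; rewrite addr_ge0// invr_ge0 ltW.
have r1 : 0 < r^-1 by rewrite invr_gt0.
have x0 := normr_ge0 x.
split; first by rewrite ltW//; lra.
move=> y yx; apply: rU; apply: (le_trans (ltW yx)).
rewrite -[leRHS]invrK lef_pV2 ?posrE//.
apply: (@le_trans _ _ j%:R); first by lra.
by rewrite ler_nat.
Qed.

End compact_exhaustion.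

(** * Affine families from tangents of strictly convex functions *)

Section strict_supports.
Context {R : realType} {n : nat}.

Definition has_supports (U : set 'rV[R]_n) (F : 'rV[R]_n -> R) (P : 'rV[R]_n -> 'rV[R]_n) :=
  forall z y, U z -> U y -> F z + dotv (P z) (y - z) <= F y.

Definition strict_supports (U : set 'rV[R]_n) (F : 'rV[R]_n -> R) (P : 'rV[R]_n -> 'rV[R]_n) :=
  forall K, compact K -> K `<=` U -> forall d, 0 < d -> exists2 k, 0 < k &
    forall z y, K z -> K y -> d <= `|z - y| -> F z + dotv (P z) (y - z) + k <= F y.

(* The last condition lets the exponential sum with growing rates converge even
   slightly below the supremum of the family. *)
Definition affine_family (U : set 'rV[R]_n) (F : 'rV[R]_n -> R) (e : R)
    (p : nat -> 'rV[R]_n) (b : nat -> R) :=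
  let l k x := b k + dotv (p k) x in
  [/\ forall k x, U x -> l k x <= F x,
      forall x, U x -> exists k, F x - e <= l k x
    & forall a, U a -> exists i r eta k0, [/\ 0 < r, 0 < eta &
        forall k x, (k0 <= k)%N -> `|x - a| <= r -> l k x <= l i a - eta]].

Lemma has_supports_convex U F P : convex_set U -> has_supports U F P ->
  convex_function U F.
Proof.
move=> cU sF t x y; rewrite !inE => Ux Uy.
have t0 : 0 <= t%:num by exact: ge0.
have t1 : 0 <= 1 - t%:num by rewrite subr_ge0; exact: le1.
rewrite convex_combE; set z := _ + _.
have Uz : U z by apply: convex_set_comb => //; rewrite t0/= -subr_ge0.
have -> : conv t (F x : R^o) (F y) = t%:num * F x + (1 - t%:num) * F y by [].
apply: le_trans (lerD (ler_wpM2l t0 (sF z x Uz Ux)) (ler_wpM2l t1 (sF z y Uz Uy))).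
rewrite !dotvB {4 6}/z dotvD !dotvZ le_eqVlt; apply/orP; left; apply/eqP; ring.
Qed.

(** Strictness is given on compact sets only, while [x] ranges over all of [U] outside a layer. The
    segment from [y] to [x] is cut at a point [z] of the compact layer [j.+1], and the tangent at
    [x] is compared with the one at [z]. *)
Lemma exhaust_strict_gap U F P j : convex_set U -> has_supports U F P ->
  strict_supports U F P -> exists2 k, 0 < k &
  forall x y, U x -> ~ exhaust U j.+1 x -> exhaust U j y ->
    F x + dotv (P x) (y - x) + k <= F y.
Proof.
move=> cU sF ssF.
have d0 := exhaust_gap_gt0 (R := R) j.
have [k k0 kP] := ssF _ (exhaust_compact (U := U) (j := j.+1)) (@exhaust_sub R n U j.+1) _ d0.
exists k => // x y Ux xj yj.
have Uy := exhaust_sub yj.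
set d := (exhaust_gap j : R) in d0 kP.
have dxy : d < `|x - y|.
  by rewrite ltNge; apply/negP => /(exhaust_near yj).
have xy0 : 0 < `|x - y| by apply: lt_trans dxy.
pose s := d / `|x - y|.
have s0 : 0 < s by rewrite divr_gt0.
have s1 : s < 1 by rewrite ltr_pdivrMr// mul1r.
have s01 : 0 <= s <= 1 by rewrite !ltW.
pose z := s *: x + (1 - s) *: y.
have Uz : U z by exact: convex_set_comb.
have zy : z - y = s *: (x - y).
  by rewrite /z scalerBl scale1r scalerBr addrA addrAC addrK.
have nzy : `|z - y| = d.
  by rewrite zy normrZ gtr0_norm// divfK// gt_eqF.
have zj : exhaust U j.+1 z by apply: exhaust_near yj _; rewrite nzy.
have yj1 : exhaust U j.+1 y by apply: exhaust_mono yj.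
have := kP z y zj yj1; rewrite nzy lexx => /(_ isT).
have := sF z x Uz Ux; have := sF x z Ux Uz.
rewrite !dotvB {2 4 6}/z !dotvD !dotvZ; set A := dotv (P x) x; set B := dotv (P x) y.
set C := dotv (P z) x; set D := dotv (P z) y => h1 h2 h3.
(* The tangent at [x] minus the tangent at [z] is affine along the line, nonnegative at [x] and
   nonpositive at [z], hence nonpositive at [y], which lies beyond [z]. *)
suff : (1 - s) * (F x + B - A) <= (1 - s) * (F z + (D - (s * C + (1 - s) * D))).
  by rewrite ler_pM2l ?subr_gt0//; lra.
have := ler_wpM2l (ltW s0) h2; lra.
Qed.

Lemma compact_cover_seq (K : set 'rV[R]_n) (N : 'rV[R]_n -> set 'rV[R]_n) :
  compact K -> (forall x, K x -> nbhs x (N x)) ->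
  exists s : seq 'rV[R]_n, (forall x, x \in s -> K x) /\
    forall y, K y -> exists2 x, x \in s & N x y.
Proof.
rewrite compact_cover => cK KN.
have [|y Ky|D DK KD] := cK _ K (fun x => interior (N x)).
- by move=> x _; exact: open_interior.
- by exists y => //; exact: KN.
exists (finmap.enum_fset D); split=> [x /DK|y /KD[x /= xD xy]]; first by rewrite inE.
by exists x => //; exact: interior_subset xy.
Qed.

(** Near a given point, tangents from far layers stay below [F] by a fixed amount, whereas the cover
    of the point's own layer is fine enough to contain a tangent much closer to [F]. *)
Lemma affine_family_exists (U : set 'rV[R]_n) (F : 'rV[R]_n -> R)
    (P : 'rV[R]_n -> 'rV[R]_n) (e : R) : open U -> convex_set U -> U !=set0 ->
  has_supports U F P -> strict_supports U F P -> 0 < e ->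
  exists p b, affine_family U F e p b.
Proof.
move=> oU cU [x0 Ux0] sF ssF e0.
have cF := has_supports_convex cU sF.
have /choice[ka kaP] : forall j, exists k, 0 < k /\
    forall x y, U x -> ~ exhaust U j.+1 x -> exhaust U j y ->
    F x + dotv (P x) (y - x) + k <= F y.
  by move=> j; have [k k0 kP] := exhaust_strict_gap j cU sF ssF; exists k.
(* The three bounds serve the tangents of far layers, the filler functions lowered by 1, and the
   accuracy [e]. *)
pose et j := Num.min (ka j) (Num.min 1 e).
have et0 j : 0 < et j by rewrite !lt_min (kaP j).1 ltr01 e0.
have et1 j : et j <= 1 by rewrite !ge_min lexx orbT.
have ete j : et j <= e by rewrite !ge_min lexx !orbT.
have etka j : et j <= ka j by rewrite !ge_min lexx.
pose l z x := F z + dotv (P z) (x - z).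
pose inner j := if j is i.+1 then interior (exhaust U i) else set0.
pose C j := exhaust U j `&` ~` inner j.
have Ccpt j : compact (C j).
  apply: compact_closedI; first exact: exhaust_compact.
  by apply: open_closedC; case: j => [|j]; [exact: open0|exact: open_interior].
have /choice[X XP] : forall j, exists s : seq 'rV[R]_n,
    (forall x, x \in s -> C j x) /\
    forall y, C j y -> exists2 x, x \in s & F y - et j.+1 / 4 <= l x y.
  move=> j; apply: compact_cover_seq => // x [xj _].
  have Ux := exhaust_sub xj.
  pose t := et j.+1 / 8; have t0 : 0 < t by rewrite divr_gt0.
  have [r r0 rP] := convex_upper_semicontinuous oU cU cF Ux t0.
  have B0 : 0 < dual_norm (P x) + 1 by rewrite ltr_wpDl// dual_norm_ge0.
  apply/nbhs_ballP; exists (Num.min r (t / (dual_norm (P x) + 1))).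
    by rewrite /= lt_min r0 divr_gt0.
  move=> y; rewrite -ball_normE /= distrC lt_min => /andP[yr yt].
  have [_ Fy] := rP y (ltW yr).
  have : `|dotv (P x) (y - x)| <= t.
    apply: le_trans (dotv_le _ _) _; move: yt; rewrite ltr_pdivlMr// => yt.
    have := normr_ge0 (y - x); lra.
  rewrite ler_norml => /andP[h _]; rewrite /l.
  have tE : et j.+1 / 4 = 2 * t by rewrite /t; field.
  lra.
have minimal a : U a -> exists2 j, C j a & exhaust U j a.
  move=> Ua; have [j0 aj0] := exhaust_cover oU Ua.
  have ex : exists j, `[< exhaust U j a >] by exists j0; apply/asboolP.
  case: (ex_minnP ex) => j /asboolP aj jmin; exists j => //; split=> //.
  case: j aj jmin => [|j] aj jmin; first by case.
  move=> aj1.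
  have aj' : exhaust U j a := interior_subset aj1.
  by have := jmin j; rewrite ltnn => h; apply: notF; apply: h; apply/asboolP.
(* An index codes a layer and a position in its list of points. Any other index gets the tangent at
   [x0] lowered by 1, which stays below [F] by at least 1. *)
pose pt k : option 'rV[R]_n := if (pickle_inv k : option (nat * nat)) is Some (j, i)
  then if (i < size (X j))%N then Some (nth 0 (X j) i) else None else None.
pose p k := if pt k is Some x then P x else P x0.
pose b k := if pt k is Some x then F x - dotv (P x) x else F x0 - dotv (P x0) x0 - 1.
pose L k x := b k + dotv (p k) x.
have LE k x : L k x = if pt k is Some z then l z x else l x0 x - 1.
  rewrite /L /b /p /l; case: (pt k) => [z|]; rewrite dotvB; ring.
have XU j x : x \in X j -> U x by move=> /(XP j).1[/exhaust_sub].
have ptU k z : pt k = Some z -> U z.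
  rewrite /pt; case: pickle_inv => // -[j i]; case: ifP => // iX [<-].
  by apply: (XU j); rewrite mem_nth.
have LF k x : U x -> L k x <= F x.
  move=> Ux; rewrite LE; case E: (pt k) => [z|]; first exact: sF (ptU _ _ E) Ux.
  have := sF _ _ Ux0 Ux; rewrite /l; lra.
have pick a : U a -> exists j k, exhaust U j a /\ F a - et j.+1 / 4 <= L k a.
  move=> Ua; have [j Ca aj] := minimal a Ua.
  have [z zX zP] := (XP j).2 a Ca.
  exists j, (pickle (j, index z (X j))); split=> //.
  by rewrite LE /pt pickleK_inv index_mem zX nth_index.
exists p, b; split=> [|x Ux|a Ua].
- exact: LF.
- have [j [k [_ Fk]]] := pick x Ux; exists k; apply: le_trans Fk.
  have := ete j.+1; have := et0 j.+1; lra.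
have [j [i [aj Fi]]] := pick a Ua.
have e4 : 0 < et j.+1 / 4 by rewrite divr_gt0.
have [r r0 rP] := convex_upper_semicontinuous oU cU cF Ua e4.
(* From [k0] on, only fillers and points of layers at least [j + 4] occur. The latter avoid the
   interior of layer [j + 3], hence layer [j + 2], so the gap [ka j.+1] applies on layer [j + 1],
   which surrounds [a]. Of the margin [et j.+1], one quarter goes to the growth of [F] near [a] and
   one to the accuracy at [a], leaving half. *)
pose k0 := (\max_(j' < j + 4) \max_(i' < size (X j')) (pickle (val j', val i'))).+1.
exists i, (Num.min r ((exhaust_gap j : R))), (et j.+1 / 2), k0; split.
- by rewrite lt_min r0 exhaust_gap_gt0.
- by rewrite divr_gt0.
move=> k x k0k; rewrite le_min => /andP[xr xd].
have [Ux Fx] := rP x xr.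
have xj := exhaust_near aj xd.
rewrite -/(L k x) -/(L i a) LE; case E: (pt k) => [z|].
  suff zj : ~ exhaust U j.+2 z.
    have := (kaP j.+1).2 z x (ptU _ _ E) zj xj; rewrite -/(l z x).
    have := etka j.+1; lra.
  move=> zj; move: E; rewrite /pt.
  case E: (pickle_inv k) => [[j' i']|//]; case: ifP => // i'X [zE].
  have kE : k = pickle (j', i').
    by have := pickle_invK (T := (nat * nat)%type) k; rewrite E.
  have jj' : (j + 4 <= j')%N.
    rewrite leqNgt; apply/negP => j'j; move: k0k; rewrite /k0 leqNgt => /negP; apply.
    rewrite ltnS kE; apply: leq_trans (leq_bigmax (Ordinal j'j)) => /=.
    exact: (leq_bigmax (Ordinal i'X)).
  have zX : z \in X j' by rewrite -zE mem_nth.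
  have [_ nz] := (XP j').1 z zX; case: j' => [|j'] in jj' i'X zE zX E kE nz *.
    by move: jj'; rewrite addnS.
  apply: nz.
  have : exhaust U (j.+3) `<=` exhaust U j'.
    by apply: exhaust_mono; move: jj'; rewrite addnS ltnS addn3.
  move=> /interiorS; apply; exact: exhaust_interior.
have := sF _ _ Ux0 Ux; rewrite -/(l x0 x); have := et1 j.+1; lra.
Qed.

End strict_supports.

(** * A strictly convex substitute for the positive part *)

Section smooth_positive_part.
Context {R : realType}.
Implicit Types t L : R.

Definition root4 t : R := Num.sqrt (t ^+ 2 + 4).
(** The positive root y of y^2 - t y - 1 = 0, a branch of a hyperbola asymptotic to the graph of the
    positive part. *)
Definition smooth_pos t : R := (t + root4 t) / 2.
Definition smooth_pos' t : R := (1 + t / root4 t) / 2.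

Lemma root4_gt0 t : 0 < root4 t.
Proof. by rewrite sqrtr_gt0 ltr_wpDl// sqr_ge0. Qed.

Lemma root4_sqr t : root4 t ^+ 2 = t ^+ 2 + 4.
Proof. by rewrite sqr_sqrtr// addr_ge0// sqr_ge0. Qed.

Lemma root4_le t : root4 t <= `|t| + 2.
Proof.
rewrite -(ler_pXn2r (_ : (0 < 2)%N))// ?nnegrE ?addr_ge0// ?(ltW (root4_gt0 t))//.
rewrite root4_sqr (_ : (`|t| + 2) ^+ 2 = `|t| ^+ 2 + 4 * `|t| + 4); last by ring.
rewrite real_normK ?num_real//.
by have := normr_ge0 t; lra.
Qed.

Lemma root4_ge t : `|t| <= root4 t.
Proof.
rewrite -(ler_pXn2r (_ : (0 < 2)%N))// ?nnegrE// ?(ltW (root4_gt0 t))//.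
by rewrite root4_sqr real_normK ?num_real//; lra.
Qed.

Lemma smooth_pos_ge0 t : 0 <= smooth_pos t.
Proof.
have := root4_ge t; rewrite ler_norml => /andP[h _].
by rewrite /smooth_pos divr_ge0//; lra.
Qed.

Lemma smooth_pos_le t : smooth_pos t <= Num.max t 0 + 1.
Proof.
have := root4_le t; rewrite /smooth_pos; have [t0|t0] := leP 0 t.
  by rewrite ger0_norm//; lra.
by rewrite ltr0_norm//; lra.
Qed.

Lemma smooth_pos_tangent t t0 L : `|t| <= L -> `|t0| <= L ->
  smooth_pos t0 + smooth_pos' t0 * (t - t0) + (t - t0) ^+ 2 / (L + 2) ^+ 3
    <= smooth_pos t.
Proof.
move=> tL t0L; have r0 := root4_gt0 t; have r00 := root4_gt0 t0.
have rL : root4 t <= L + 2 by have := root4_le t; lra.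
have r0L : root4 t0 <= L + 2 by have := root4_le t0; lra.
have E := root4_sqr t; have E0 := root4_sqr t0.
rewrite /smooth_pos /smooth_pos'; set r := root4 t in r0 rL E *.
set s := root4 t0 in r00 r0L E0 *.
have L0 : 0 < L + 2 by apply: lt_le_trans rL.
(* [r] and [s] are the Euclidean norms of (t, 2) and (t0, 2); [G] is their Cauchy-Schwarz defect,
   and [GE] is Lagrange's identity. *)
pose G := r * s - 4 - t * t0.
have GE : G * (r * s + 4 + t * t0) = 4 * (t - t0) ^+ 2.
  rewrite /G (_ : _ * _ = r ^+ 2 * s ^+ 2 - (4 + t * t0) ^+ 2); last by ring.
  by rewrite E E0; ring.
have G0 : 0 <= G.
  rewrite leNgt; apply/negP => Gn; have rs : 0 < r * s := mulr_gt0 r0 r00.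
  have h : 0 < r * s + 4 + t * t0 by rewrite /G in Gn; lra.
  have : 0 <= G * (r * s + 4 + t * t0) by rewrite GE mulr_ge0// sqr_ge0.
  by rewrite pmulr_lge0// leNgt Gn.
have G2 : 4 * (t - t0) ^+ 2 <= G * (2 * (r * s)).
  by rewrite -GE ler_wpM2l//; rewrite /G in G0; lra.
have dE : (t + r) / 2 - (t0 + s) / 2 - (1 + t0 / s) / 2 * (t - t0) = G / (2 * s).
  have sn : s != 0 by rewrite gt_eqF.
  transitivity ((r * s - s ^+ 2 - t * t0 + t0 ^+ 2) / (2 * s)); first by field.
  by rewrite E0 /G; congr (_ / _); ring.
suff : (t - t0) ^+ 2 / (L + 2) ^+ 3 <= G / (2 * s) by rewrite -dE; lra.
apply: (@le_trans _ _ ((t - t0) ^+ 2 / (r * s ^+ 2))).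
  apply: ler_wpM2l; first exact: sqr_ge0.
  rewrite lef_pV2 ?posrE ?exprn_gt0//; last by rewrite mulr_gt0// exprn_gt0.
  rewrite [leRHS]exprS; apply: ler_pM; [exact: ltW|exact: sqr_ge0|exact: rL|].
  by apply: lerXn2r; rewrite ?nnegrE ?(ltW r00) ?(ltW L0).
rewrite ler_pdivrMr ?mulr_gt0 ?exprn_gt0//.
have -> : G / (2 * s) * (r * s ^+ 2) = G * (2 * (r * s)) / 4.
  by field; rewrite gt_eqF.
by rewrite ler_pdivlMr//; lra.
Qed.

End smooth_positive_part.

(** * Strictly convex approximation under coordinate lower bounds *)

Section nondegenerate_functions.
Context {R : realType} {n : nat}.

Lemma norm_sqr_le (v : 'rV[R]_n) : `|v| ^+ 2 <= \sum_(i < n) v ord0 i ^+ 2.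
Proof.
have S0 : 0 <= \sum_(i < n) v ord0 i ^+ 2 by apply: sumr_ge0 => i _; exact: sqr_ge0.
rewrite -[leRHS]sqr_sqrtr//; apply: lerXn2r; rewrite ?nnegrE ?sqrtr_ge0//.
apply: norm_le_coord; first exact: sqrtr_ge0.
move=> i; rewrite -sqrtr_sqr ler_wsqrtr// (bigD1 i)//= lerDl.
by apply: sumr_ge0 => j _; exact: sqr_ge0.
Qed.

Lemma compact_bounded_above (K : set 'rV[R]_n) (g : 'rV[R]_n -> R) : compact K ->
  (forall x, K x -> \forall y \near x, g y <= g x + 1) ->
  exists B, forall x, K x -> g x <= B.
Proof.
move=> cK gK; have [s [_ sK]] := compact_cover_seq cK gK.
have [B sB] : exists B, forall x, x \in s -> g x + 1 <= B.
  elim: (s) => [|x s' [B IH]]; first by exists 0.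
  exists (Num.max (g x + 1) B) => y; rewrite inE => /orP[/eqP ->|/IH yB].
    by rewrite le_max lexx.
  by rewrite le_max yB orbT.
by exists B => y /sK[x /sB xB yx]; apply: le_trans yx xB.
Qed.

(* F = f - e + e^2 / (4 (f - psi)) is the supremum over s in [0, 1] of
   (1 - s^2) f + s^2 psi + e s - e, attained at s = e / (2 (f - psi)); it
   inherits strict convexity from psi and stays between f - e and f - e / 2. *)
Lemma strictly_convex_approximation (U : set 'rV[R]_n) (f : 'rV[R]_n -> R) (c e : R) :
  open U -> convex_set U -> convex_function U f -> 0 < e ->
  (forall x, U x -> c <= f x) -> (forall x i, U x -> x ord0 i + c <= f x) ->
  exists F P, [/\ has_supports U F P, strict_supports U F P
    & forall x, U x -> f x - e <= F x <= f x - e / 2].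
Proof.
move=> oU cU cf e0 fc fi.
have /choice[q qP] : forall z, exists q, U z -> forall x, U x -> f z + dotv q (x - z) <= f x.
  move=> z; have [Uz|nUz] := pselect (U z); last by exists 0.
  by have [q qP] := subgradient_exists oU cU cf Uz; exists q.
pose N : R := n.+1%:R^-1; have N0 : 0 < N by rewrite invr_gt0.
(* Each [smooth_pos (x ord0 i)] is at most [f x - c + 1]; the weight 1/(n+1) brings the sum of n of
   them under the same bound, and the constant then moves [psi] below [f - e / 2]. *)
pose psi (x : 'rV[R]_n) := N * (\sum_(i < n) smooth_pos (x ord0 i)) + (c - 1 - e / 2).
pose gr (z : 'rV[R]_n) : 'rV[R]_n := \row_i (N * smooth_pos' (z ord0 i)).
have psi_f x : U x -> psi x <= f x - e / 2.
  move=> Ux; have fc0 : 0 <= f x - c + 1 by have := fc x Ux; lra.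
  have : N * (\sum_(i < n) smooth_pos (x ord0 i)) <= N * (n%:R * (f x - c + 1)).
    rewrite ler_pM2l// -[n in n%:R]card_ord -sum1_card natr_sum mulr_suml.
    apply: ler_sum => i _; rewrite mul1r.
    apply: le_trans (smooth_pos_le _) _; rewrite lerD2r ge_max.
    by have := fc x Ux; have := fi x i Ux; move=> h1 h2; apply/andP; split; lra.
  have : N * (n%:R * (f x - c + 1)) <= f x - c + 1.
    by rewrite mulrA ler_piMl// /N mulrC ler_pdivrMr// mul1r ler_nat.
  rewrite /psi; lra.
have psi_tangent z x L : `|z| <= L -> `|x| <= L ->
    psi z + dotv (gr z) (x - z) + N / (L + 2) ^+ 3 * `|x - z| ^+ 2 <= psi x.
  move=> zL xL; have L0 : 0 < L + 2 by apply: ltr_wpDl => //; apply: le_trans zL.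
  have k0 : 0 <= N / (L + 2) ^+ 3 by rewrite divr_ge0 ?exprn_ge0// ltW.
  apply: le_trans (lerD (lexx _) (ler_wpM2l k0 (norm_sqr_le (x - z)))) _.
  suff : N * (\sum_(i < n) smooth_pos (z ord0 i)) + dotv (gr z) (x - z) +
      N / (L + 2) ^+ 3 * (\sum_(i < n) (x - z) ord0 i ^+ 2) <=
      N * (\sum_(i < n) smooth_pos (x ord0 i)) by rewrite /psi; lra.
  rewrite /dotv !mulr_sumr -!big_split /=; apply: ler_sum => i _.
  have := smooth_pos_tangent (le_trans (coord_le_norm x i) xL) (le_trans (coord_le_norm z i) zL).
  move=> /(ler_wpM2l (ltW N0)) h; rewrite !mxE; apply: le_trans h; rewrite le_eqVlt; apply/orP; left.
  by apply/eqP; ring.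
pose D z := f z - psi z.
have D_ge z : U z -> e / 2 <= D z by move=> /psi_f; rewrite /D; lra.
have e20 : 0 < e / 2 by rewrite divr_gt0.
have D0 z : U z -> 0 < D z by move=> /D_ge; exact: lt_le_trans.
pose s z := e / (2 * D z).
pose F z := f z - e + e ^+ 2 / (4 * D z).
(* The parameter optimal at [z] is frozen: [F] is supported at [z] by the support of that one member
   of the family. *)
pose P z := (1 - s z ^+ 2) *: q z + s z ^+ 2 *: gr z.
have s0 z : U z -> 0 <= s z by move=> /D0 h; rewrite divr_ge0 ?mulr_ge0// ltW.
have s1 z : U z -> s z <= 1.
  move=> Uz; rewrite ler_pdivrMr ?mulr_gt0 ?D0// mul1r.
  have := D_ge z Uz; lra.
have FE z : U z -> F z = (1 - s z ^+ 2) * f z + s z ^+ 2 * psi z + (e * s z - e).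
  move=> /D0 h; have -> : psi z = f z - D z by rewrite /D opprB addrC subrK.
  by rewrite /F /s; field; rewrite gt_eqF.
have main z y L : U z -> U y -> `|z| <= L -> `|y| <= L ->
    F z + dotv (P z) (y - z) + s z ^+ 2 * (N / (L + 2) ^+ 3 * `|y - z| ^+ 2) <= F y.
  move=> Uz Uy zL yL; have s20 : 0 <= s z ^+ 2 by exact: sqr_ge0.
  have s21 : 0 <= 1 - s z ^+ 2 by rewrite subr_ge0 exprn_ile1// ?s0 ?s1.
  have h1 := ler_wpM2l s21 (qP z Uz y Uy).
  have h2 := ler_wpM2l s20 (psi_tangent z y L zL yL).
  have h3 : f y - s z ^+ 2 * D y + (e * s z - e) <= F y.
    have := D0 y Uy; rewrite /F => Dy.
    (* What is lost at [y] by using the parameter of [z] is exactly this square. *)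
    have : 0 <= (e - 2 * s z * D y) ^+ 2 / (4 * D y).
      by rewrite divr_ge0 ?sqr_ge0 ?mulr_ge0// ltW.
    have -> : (e - 2 * s z * D y) ^+ 2 / (4 * D y) =
        e ^+ 2 / (4 * D y) - e * s z + s z ^+ 2 * D y by field; rewrite gt_eqF.
    lra.
  apply: le_trans h3; rewrite (FE z Uz) /P dotvDl !dotvZl /D.
  by move: h1 h2; set t := s z ^+ 2; lra.
exists F, P; split.
- move=> z y Uz Uy; pose L := Num.max `|z| `|y|.
  have zL : `|z| <= L by rewrite le_max lexx.
  have yL : `|y| <= L by rewrite le_max lexx orbT.
  apply: le_trans (main z y L Uz Uy zL yL); rewrite lerDl.
  have L0 : 0 <= L + 2 by rewrite addr_ge0//; apply: le_trans zL.
  by rewrite mulr_ge0 ?sqr_ge0// mulr_ge0 ?sqr_ge0// divr_ge0 ?exprn_ge0// ltW.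
- move=> K cK KU d d0.
  have [L KL] : exists L, forall x, K x -> `|x| <= L.
    apply: compact_bounded_above cK _ => x _.
    apply/nbhs_ballP; exists 1 => //= y; rewrite -ball_normE /= => xy.
    have := ler_normD x (y - x); rewrite [x + _]addrC subrK distrC; lra.
  have [B KB] : exists B, forall x, K x -> f x <= B.
    apply: compact_bounded_above cK _ => x Kx.
    have [r r0 rP] := convex_upper_semicontinuous oU cU cf (KU _ Kx) ltr01.
    apply/nbhs_ballP; exists r => //= y; rewrite -ball_normE /= distrC => xy.
    exact: (rP y (ltW xy)).2.
  (* An upper bound of [D] on [K] keeps [s] away from 0 there, which preserves a fixed share of the
     strict convexity of [psi]. *)
  pose M := Num.max 1 (B - (c - 1 - e / 2)).
  have M0 : 0 < M by rewrite lt_max ltr01.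
  have DM z : K z -> D z <= M.
    move=> Kz; rewrite le_max; apply/orP; right; have := KB z Kz.
    have : 0 <= N * (\sum_(i < n) smooth_pos (z ord0 i)).
      apply: mulr_ge0 (ltW N0) _; apply: sumr_ge0 => i _; exact: smooth_pos_ge0.
    rewrite /D /psi; lra.
  pose L' := Num.max L 0; have L0 : 0 < L' + 2.
    by rewrite ltr_wpDl// le_max lexx orbT.
  have KL' x : K x -> `|x| <= L' by move=> /KL h; rewrite le_max h.
  exists ((e / (2 * M)) ^+ 2 * (N / (L' + 2) ^+ 3 * d ^+ 2)).
    have eM : 0 < e / (2 * M) by rewrite divr_gt0 ?mulr_gt0.
    have NL : 0 < N / (L' + 2) ^+ 3 by rewrite divr_gt0 ?exprn_gt0.
    by apply: mulr_gt0; [|apply: mulr_gt0 NL _]; rewrite exprn_gt0.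
  move=> z y Kz Ky dzy.
  apply: le_trans (main z y L' (KU _ Kz) (KU _ Ky) (KL' _ Kz) (KL' _ Ky)).
  rewrite lerD2l; apply: ler_pM.
  + exact: sqr_ge0.
  + by rewrite mulr_ge0 ?sqr_ge0// divr_ge0 ?exprn_ge0// ltW.
  + apply: lerXn2r; rewrite ?nnegrE ?s0 ?divr_ge0 ?mulr_ge0 ?(ltW e0) ?(ltW M0)//.
      exact: KU.
    rewrite /s ler_pM2l// lef_pV2 ?posrE ?mulr_gt0// ?ler_pM2l ?DM//.
    by apply: D0; exact: KU.
  + rewrite ler_wpM2l ?divr_ge0 ?exprn_ge0 ?(ltW N0) ?(ltW L0)//.
    by apply: lerXn2r; rewrite ?nnegrE ?(ltW d0)// distrC.
- move=> x Ux; rewrite /F; apply/andP; split.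
    by rewrite lerDl divr_ge0 ?sqr_ge0// mulr_ge0// ltW// D0.
  suff : e ^+ 2 / (4 * D x) <= e / 2 by lra.
  rewrite ler_pdivrMr ?mulr_gt0 ?D0//.
  have := ler_wpM2l (ltW e0) (D_ge x Ux); rewrite expr2; lra.
Qed.

End nondegenerate_functions.

(** * Convexity of the distance to a convex set *)

Section distance_function.
Context {R : realType} {n : nat}.
Variable U : set 'rV[R]_n.

(** A subgradient of this function at a point of positive distance is a linear form separating the
    point strictly from [U]. *)
Definition set_dist (x : 'rV[R]_n) : R := inf [set `|x - u| | u in U].

Lemma set_dist_le x u : U u -> set_dist x <= `|x - u|.
Proof. by move=> Uu; apply: ge_inf; [exists 0 => _ [v _ <-]|exists u]. Qed.

Lemma le_set_dist x r : U !=set0 -> (forall u, U u -> r <= `|x - u|) -> r <= set_dist x.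
Proof.
by move=> [u Uu] Ur; apply: lb_le_inf; [exists `|x - u|, u|move=> _ [v /Ur vr <-]].
Qed.

Lemma set_dist_convex : U !=set0 -> convex_set U -> convex_function setT set_dist.
Proof.
move=> U0 cU t x y _ _.
have t0 : 0 <= t%:num by exact: ge0.
have t1 : 0 <= 1 - t%:num by rewrite subr_ge0; exact: le1.
have -> : conv t (set_dist x : R^o) (set_dist y) =
  t%:num * set_dist x + (1 - t%:num) * set_dist y by [].
rewrite convex_combE; apply/ler_addgt0Pr => d d0.
have near_dist z : exists2 u, U u & `|z - u| < set_dist z + d.
  have [|_ [u Uu <-] ud] := @inf_adherent _ [set `|z - u| | u in U] d d0.
    by split; [case: U0 => u Uu; exists `|z - u|, u|exists 0 => _ [v _ <-]].
  by exists u.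
have [u Uu xu] := near_dist x; have [v Uv yv] := near_dist y.
have Uw : U (t%:num *: u + (1 - t%:num) *: v).
  by apply: convex_set_comb => //; rewrite t0 -subr_ge0.
apply: le_trans (set_dist_le _ Uw) _.
rewrite opprD addrACA -!scalerBr; apply: le_trans (ler_normD _ _) _.
rewrite !normrZ (ger0_norm t0) (ger0_norm t1).
apply: le_trans (lerD (ler_wpM2l t0 (ltW xu)) (ler_wpM2l t1 (ltW yv))) _.
by rewrite le_eqVlt; apply/orP; left; apply/eqP; ring.
Qed.

End distance_function.

(** * Factoring out the degenerate directions *)

Section reduction.
Context {R : realType}.

Lemma dotvE n (p x : 'rV[R]_n) : dotv p x = (x *m p^T) ord0 ord0.
Proof. by rewrite mxE; apply: eq_bigr => i _; rewrite mxE mulrC. Qed.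

Lemma dotv_mulmx m n (p : 'rV[R]_m) (A : 'M[R]_(m, n)) (x : 'rV[R]_n) :
  dotv (p *m A) x = dotv p (x *m A^T).
Proof. by rewrite !dotvE trmx_mul mulmxA. Qed.

Lemma mulmx_tr_row m n (A : 'M[R]_(m, n)) (x : 'rV[R]_n) i :
  (x *m A^T) ord0 i = dotv (row i A) x.
Proof. by rewrite mxE; apply: eq_bigr => j _; rewrite !mxE mulrC. Qed.

Lemma norm_mulmx_le m n (A : 'M[R]_(m, n)) :
  exists2 C, 0 < C & forall x : 'rV[R]_n, `|x *m A^T| <= C * `|x|.
Proof.
exists (1 + \sum_i dual_norm (row i A)).
  by rewrite ltr_wpDr// sumr_ge0// => i _; exact: dual_norm_ge0.
move=> x; have S0 j : 0 <= dual_norm (row j A) by exact: dual_norm_ge0.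
apply: norm_le_coord.
  by rewrite mulr_ge0// addr_ge0// sumr_ge0.
move=> i; rewrite mulmx_tr_row; apply: le_trans (dotv_le _ _) _.
rewrite ler_wpM2r// (bigD1 i)//= addrCA lerDl addr_ge0// sumr_ge0//.
Qed.

(** The ball shrinks by a Lipschitz constant of the linear map, and further until [p0] varies by at
    most [eta / 2] on it; the other half of the gap survives. *)
Lemma affine_family_pullback m n (A : 'M[R]_(m, n)) (p0 : 'rV[R]_n)
    (U : set 'rV[R]_n) (V : set 'rV[R]_m) F e p b :
  (forall x, U x -> V (x *m A^T)) -> affine_family V F e p b ->
  affine_family U (fun x => F (x *m A^T) + dotv p0 x) e
    (fun k => p0 + p k *m A) b.
Proof.
move=> UV [pF Fp gap].
have lE k x : b k + dotv (p0 + p k *m A) x =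
    b k + dotv (p k) (x *m A^T) + dotv p0 x.
  by rewrite dotvDl dotv_mulmx; ring.
split=> [k x Ux|x Ux|a Ua].
- by rewrite lE lerD2r; apply: pF; exact: UV.
- by have [k kF] := Fp _ (UV _ Ux); exists k; rewrite lE addrAC lerD2r.
have [i [r [eta [k0 [r0 eta0 far]]]]] := gap _ (UV _ Ua).
have [C C0 CP] := norm_mulmx_le A.
have D0 : 0 < 1 + dual_norm p0 by rewrite ltr_wpDr// dual_norm_ge0.
exists i, (Num.min (r / C) (eta / 2 / (1 + dual_norm p0))), (eta / 2), k0; split.
- by rewrite lt_min !divr_gt0.
- by rewrite divr_gt0.
move=> k x k0k; rewrite le_min => /andP[xr xe]; rewrite !lE.
have := far k (x *m A^T) k0k; rewrite -mulmxBl => h.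
have {}h := h (le_trans (CP _) _); rewrite ler_pdivlMr// in xr; rewrite mulrC in xr.
have {}h := h xr.
have : `|dotv p0 (x - a)| <= eta / 2.
  apply: le_trans (dotv_le _ _) _; move: xe; rewrite ler_pdivlMr// => xe.
  have := normr_ge0 (x - a); lra.
rewrite dotvB ler_norml => /andP[_ h2]; lra.
Qed.

(** These slopes form the domain of the convex conjugate of [f] extended by infinity outside [U]. *)
Definition minorant_slope n (U : set 'rV[R]_n) (f : 'rV[R]_n -> R) (q : 'rV[R]_n) :=
  exists b, forall x, U x -> b + dotv q x <= f x.

(** A maximal independent family chosen among differences of actual slopes: each row then bounds [f]
    from below in its own direction, as the coordinate bounds of the reduced function demand. *)
Lemma minorant_slopes_span n (U : set 'rV[R]_n) f p0 :
  exists m (A : 'M[R]_(m, n)), [/\ row_free A,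
    forall i, minorant_slope U f (p0 + row i A)
    & forall q, minorant_slope U f q -> (q - p0 <= A)%MS].
Proof.
pose free m := `[< exists A : 'M[R]_(m, n), row_free A /\
  forall i, minorant_slope U f (p0 + row i A) >].
have free0 : exists m, free m.
  exists 0%N; apply/asboolP; exists 0; split; last by case.
  by rewrite -row_leq_rank.
have freen m : free m -> (m <= n)%N.
  by move=> /asboolP[A [/eqP Am _]]; rewrite -Am; exact: rank_leq_col.
case: (ex_maxnP free0 freen) => m /asboolP[A [Afree Aslope]] mmax.
exists m, A; split=> // q qf; apply/negPn/negP => qA.
suff : free (m + 1)%N by move=> /mmax; rewrite addn1 ltnn.
apply/asboolP; exists (col_mx A (q - p0)); split.
  rewrite -row_leq_rank -addsmxE addn1.
  apply: (@leq_ltn_trans (\rank A)); first by rewrite (eqP Afree).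
  apply: rank_ltmx.
  rewrite ltmxE addsmxSl /=; apply: contra qA; apply: submx_trans.
  exact: addsmxSr.
move=> i; case: (split_ordP i) => j ->.
  by rewrite rowKu.
by rewrite rowKd row_id// addrC subrK.
Qed.

(** All minorant slopes agree with [p0] on the kernel of [A^T], which makes [U] invariant and [f]
    affine along it. After subtraction of [p0], [f] depends only on [x *m A^T], and in these
    coordinates the rows of [A] give the lower bounds required for the strictly convex
    approximation. *)
Lemma affine_family_convex n (U : set 'rV[R]_n) (f : 'rV[R]_n -> R) (e d : R) :
  open U -> convex_set U -> convex_function U f -> U !=set0 -> 0 < e -> 0 < d ->
  exists F p b, (forall x, U x -> f x - e <= F x <= f x - e / 2) /\
    affine_family U F d p b.
Proof.
move=> oU cU cf [x0 Ux0] e0 d0.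
have slope x : U x -> exists2 q, minorant_slope U f q &
    forall y, U y -> f x + dotv q (y - x) <= f y.
  move=> Ux; have [q qP] := subgradient_exists oU cU cf Ux; exists q => //.
  exists (f x - dotv q x) => y Uy; have := qP y Uy; rewrite dotvB; lra.
have [p0 [b0 b0P] _] := slope x0 Ux0.
have [m [A [Afree Aslope Aspan]]] := minorant_slopes_span U f p0.
have ker q w : minorant_slope U f q -> w *m A^T = 0 -> dotv q w = dotv p0 w.
  move=> /Aspan/submxP[D DE] wA; apply/eqP; rewrite -subr_eq0 -dotvBl DE.
  by rewrite dotv_mulmx wA dotv0.
(* If [x + w] were outside [U], then [x + 2 *: w] would have positive distance from [U]. A form
   separating it from [U], added to [p0], would again be a minorant slope, yet not agree with [p0]
   on [w]. *)
have invU x w : U x -> w *m A^T = 0 -> U (x + w).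
  move=> Ux wA; apply: contrapT => nU.
  have [r r0 rU] := open_closed_ball oU Ux.
  have U0 : U !=set0 by exists x.
  pose z := x + 2 *: w.
  have far : r <= set_dist U z.
    apply: le_set_dist => // u Uu; rewrite leNgt; apply/negP => zu; apply: nU.
    have -> : x + w = (1 / 2) *: u + (1 - 1 / 2) *: (x + (z - u)).
      by apply/rowP => i; rewrite !mxE; field.
    apply: convex_set_comb => //; first by apply/andP; split; lra.
    by apply: rU; rewrite addrAC subrr add0r ltW.
  have [h hP] := subgradient_exists (@openT _) (fun _ _ _ _ _ => mem_setT _)
    (set_dist_convex U0 cU) (I : setT z).
  have hU u : U u -> dotv h u <= dotv h z - r.
    move=> Uu; have := hP u I; have := set_dist_le u Uu; rewrite subrr normr0.
    rewrite dotvB; lra.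
  have hs : minorant_slope U f (p0 + h).
    exists (b0 - dotv h z + r) => u Uu; have := hU u Uu; have := b0P u Uu.
    rewrite dotvDl; lra.
  have := ker _ _ hs wA; rewrite dotvDl => hw.
  have := hU x Ux; rewrite /z dotvD dotvZ; lra.
have invf x w : U x -> w *m A^T = 0 -> f x + dotv p0 w <= f (x + w).
  move=> Ux wA; have [q qs qP] := slope x Ux; have := qP _ (invU x w Ux wA).
  by rewrite addrAC subrr add0r (ker q w qs wA).
(* A linear section of the quotient map: a point and the lift of its image differ by a kernel
   vector. *)
pose B := (pinvmx A)^T.
have BA : B *m A^T = 1%:M by rewrite -trmx_mul mulmxVp// trmx1.
have wA (x : 'rV[R]_n) : (x *m A^T *m B - x) *m A^T = 0.
  by rewrite mulmxBl -(mulmxA _ B) BA mulmx1 subrr.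
pose V : set 'rV[R]_m := [set v | U (v *m B)].
pose h (v : 'rV[R]_m) := f (v *m B) - dotv p0 (v *m B).
have UV x : U x -> V (x *m A^T).
  by move=> Ux; rewrite /V /= -(subrK x (_ *m B)) addrC; apply: invU.
have hE x : U x -> f x = h (x *m A^T) + dotv p0 x.
  move=> Ux; have := invf x _ Ux (wA x).
  have := invf _ (x - x *m A^T *m B) (UV x Ux).
  rewrite -opprB mulNmx wA oppr0 => /(_ erefl).
  rewrite opprB [x + _]addrC [_ + (x - _)]addrC !subrK !dotvB /h; lra.
have oV : open V.
  rewrite openE => v /= Uv; have [r r0 rU] := open_closed_ball oU Uv.
  have [C C0 CP] := norm_mulmx_le (B^T).
  apply/nbhs_ballP; exists (r / C); first exact: divr_gt0.
  move=> w; rewrite -ball_normE /= distrC ltr_pdivlMr// => vw.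
  apply: rU; rewrite -mulmxBl; have := CP (w - v); rewrite trmxK => /le_trans; apply.
  by rewrite mulrC ltW.
have combB t (x y : 'rV[R]_m) : conv t (x : convex_lmodType _) y *m B =
    t%:num *: (x *m B) + (1 - t%:num) *: (y *m B).
  by rewrite convex_combE mulmxDl -!scalemxAl.
have cV : convex_set V.
  move=> x y t; rewrite !inE /V /= => Vx Vy; rewrite combB.
  apply: convex_set_comb => //; apply/andP; split; [exact: ge0|exact: le1].
have ch : convex_function V h.
  move=> t x y; rewrite !inE /V /= => Vx Vy.
  have -> : conv t (h x : R^o) (h y) = t%:num * h x + (1 - t%:num) * h y by [].
  rewrite /h combB.
  have t01 : 0 <= t%:num <= 1 by apply/andP; split; [exact: ge0|exact: le1].
  have hc := convex_function_comb cf t01 Vx Vy; rewrite dotvD !dotvZ.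
  apply: le_trans (lerB hc (lexx _)) _.
  by rewrite le_eqVlt; apply/orP; left; apply/eqP; ring.
have /choice[b bP] : forall i, exists b, forall x, U x -> b + dotv (p0 + row i A) x <= f x.
  exact: Aslope.
(* One constant for all lower bounds: [b0] bounds [h] itself, and the slope [p0 + row i A] gives the
   i-th coordinate bound, since [row i A] pairs with [v *m B] to [v ord0 i]. *)
pose c := b0 - \sum_i `|b i - b0|.
have c0 : c <= b0 by rewrite gerBl sumr_ge0.
have cb i : c <= b i.
  have : `|b i - b0| <= \sum_i `|b i - b0|.
    by rewrite (bigD1 i)//= lerDl sumr_ge0.
  have := ler_norm (b0 - b i); rewrite distrC /c; lra.
have [|v i Vv|F [P [sF ssF Fh]]] := @strictly_convex_approximation R m V h c e oV cV ch e0.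
- by move=> v Vv; have := b0P _ Vv; rewrite /h; lra.
- have := bP i _ Vv; rewrite dotvDl -mulmx_tr_row -(mulmxA _ B) BA mulmx1 /h.
  have := cb i; lra.
have V0 : V !=set0 by exists (x0 *m A^T); exact: UV.
have [p [b' pb]] := affine_family_exists oV cV V0 sF ssF d0.
exists (fun x => F (x *m A^T) + dotv p0 x), (fun k => p0 + p k *m A), b'; split.
  by move=> x Ux; have /andP[h1 h2] := Fh _ (UV _ Ux); rewrite hE//; apply/andP; split; lra.
exact: affine_family_pullback UV pb.
Qed.

End reduction.

Unset Implicit Arguments.

Theorem theorem1 (R : realType) (n : nat) (U : set 'rV[R]_n)
    (U_open : open U) (U_convex : convex_set U)
    (f : 'rV[R]_n -> R) (f_convex : convex_function U f)
    (eps : R) (eps_gt0 : 0 < eps) :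
  exists g : 'rV[R]_n -> R,
    [/\ real_analytic_on U g, convex_function U g
      & forall x, U x -> f x - eps <= g x <= f x].
Proof.
have [U0|/set0P/negP/negPn/eqP U0] := pselect (U !=set0); last first.
  exists f; split=> // [a|x]; rewrite U0//.
(* [F] may lie [e] below [f] and [g] another [e / 2] below [F], so [3 * e / 2] has to equal [eps].
   Above, [g <= F + e / 2] uses up the slack [F <= f - e / 2]. *)
pose e := 2 * eps / 3.
have e0 : 0 < e by rewrite divr_gt0// mulr_gt0.
have e20 : 0 < e / 2 by rewrite divr_gt0.
have [F [p [b [Ff [lF Fl gap]]]]] :=
  affine_family_convex U_open U_convex f_convex U0 e0 e20.
have [||g [ga gc gF]] := @analytic_from_affine R n U (fun x => F x + e / 2) e p b e0 _ _ gap U_convex.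
- by move=> k x Ux; rewrite addrK; exact: lF.
- by move=> x /Fl[k kF]; exists k; lra.
exists g; split=> // x Ux.
have /andP[g1 g2] := gF x Ux; have /andP[f1 f2] := Ff x Ux.
by apply/andP; split; rewrite /e in g1 g2 f1 f2; lra.
Qed.
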